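(* For every integer $m \ge 1$: (i) $p(m)$ is the maximum number $k$ such that any tree with $m$ edges can be transformed into a caterpillar with $k$ edges by contracting edges; (ii) $q(m)$ is the maximum number $k$ such that any tree with $m$ edges can be transformed into a caterpillar with $k$ edges by removing vertices.
   Context: For a family $\mathcal{S}$ of disjoint line segments in the plane, an alternating path among $\mathcal{S}$ is a simple polygonal chain in which every other segment is in $\mathcal{S}$. An alternating path among $\mathcal{S}$ is compatible with $\mathcal{S}$ if the chain does not cross any segment in $\mathcal{S}$ that is not in the chain. For $n \ge 1$, $p(n)$ (respectively, $q(n)$) is the maximum number $k$ such that any family $\mathcal{S}$ of $n$ disjoint segments in the plane, whose $2n$ endpoints are in convex position, admits an alternating path among $\mathcal{S}$ (respectively, compatible with $\mathcal{S}$) going through $k$ segments in $\mathcal{S}$. A caterpillar is a tree whose non-leaf vertices induce a path (the path may be empty, so a single edge is a caterpillar). *)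

(* Defs.v *)
From HB Require Import structures.
From mathcomp Require Import all_boot all_order all_algebra.
From mathcomp Require Import boolp classical_sets reals.
From mathcomp Require Import ring lra zify.

Set Implicit Arguments.
Unset Strict Implicit.
Unset Printing Implicit Defensive.

Import Order.TTheory GRing.Theory Num.Theory.
Local Open Scope classical_set_scope.
Local Open Scope ring_scope.

Definition is_max (A : set nat) (k : nat) : Prop :=
  A k /\ forall j, A j -> (j <= k)%N.

Section Segments.
Variable R : realType.
Local Notation plane := 'rV[R]_2.

Definition segment (x y : plane) : set plane :=
  [set (1 - t) *: x + t *: y | t in [set t : R | 0 <= t <= 1]].

Definition open_segment (x y : plane) : set plane :=
  [set (1 - t) *: x + t *: y | t in [set t : R | 0 < t < 1]].

Definition crosses (x y x' y' : plane) : Prop :=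
  open_segment x y `&` open_segment x' y' !=set0.

(* No point of the family is a convex combination of the others; this forces
   the points to be pairwise distinct and no three of them to be collinear. *)
Definition convex_position (I : finType) (P : I -> plane) : Prop :=
  forall (i : I) (w : I -> R), (forall j, 0 <= w j) -> w i = 0 ->
    \sum_j w j = 1 -> \sum_j w j *: P j <> P i.

(* A segment is given by the pair of its endpoints. *)
Definition seg_family (n : nat) := 'I_n -> plane * plane.

Definition endpoint n (S : seg_family n) (ib : 'I_n * bool) : plane :=
  if ib.2 then (S ib.1).2 else (S ib.1).1.

Definition disjoint_family n (S : seg_family n) : Prop :=
  forall i j, i != j ->
    segment (S i).1 (S i).2 `&` segment (S j).1 (S j).2 = set0.

Definition convex_family n (S : seg_family n) : Prop :=
  disjoint_family S /\ convex_position (endpoint S).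

(* A chain is the sequence v of its vertices; its i-th segment joins v`_i
   and v`_i.+1, for i.+1 < size v. *)
Definition chain_segment (v : seq plane) (i : nat) : set plane :=
  segment v`_i v`_i.+1.

Definition simple_chain (v : seq plane) : Prop :=
  [/\ (1 < size v)%N,
      forall i, (i.+1 < size v)%N -> v`_i <> v`_i.+1,
      forall i, (i.+2 < size v)%N ->
        chain_segment v i `&` chain_segment v i.+1 = [set v`_i.+1]
    & forall i j, (i.+1 < j)%N -> (j.+1 < size v)%N ->
        chain_segment v i `&` chain_segment v j = set0].

(* The i-th segment of the chain v is the segment S j, in either direction. *)
Definition is_member n (S : seg_family n) (v : seq plane) (i : nat)
    (j : 'I_n) : Prop :=
  S j = (v`_i, v`_i.+1) \/ S j = (v`_i.+1, v`_i).

(* The boolean b tells which parity class of segments of the chain lies in S. *)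
Definition alternating_path n (S : seg_family n) (v : seq plane) : Prop :=
  simple_chain v /\
  exists b : bool, forall i, (i.+1 < size v)%N ->
    (exists j, is_member S v i j) <-> odd i = b.

Definition in_chain n (S : seg_family n) (v : seq plane) (j : 'I_n) : Prop :=
  exists2 i, (i.+1 < size v)%N & is_member S v i j.

Definition compatible n (S : seg_family n) (v : seq plane) : Prop :=
  forall j, ~ in_chain S v j -> forall i, (i.+1 < size v)%N ->
    ~ crosses v`_i v`_i.+1 (S j).1 (S j).2.

Definition num_visited n (S : seg_family n) (v : seq plane) : nat :=
  #|[set j : 'I_n | `[< in_chain S v j >]]%SET|.

Definition p_set (n : nat) : set nat :=
  [set k | forall S : seg_family n, convex_family S ->
     exists2 v, alternating_path S v & num_visited S v = k].

Definition q_set (n : nat) : set nat :=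
  [set k | forall S : seg_family n, convex_family S ->
     exists2 v, alternating_path S v /\ compatible S v & num_visited S v = k].

(* The default value 0 is never used for n >= 1: see p_spec and q_spec. *)
Definition p (n : nat) : nat := xget 0%N (is_max (p_set n)).
Definition q (n : nat) : nat := xget 0%N (is_max (q_set n)).

Lemma is_maxP (A : set nat) (b k : nat) :
  A k -> (forall j, A j -> (j <= b)%N) -> is_max A (xget 0%N (is_max A)).
Proof.
move=> Ak Ab; apply: xgetPex.
have Pk : exists k, `[< A k >] by exists k; apply/asboolP.
have Pb j : `[< A j >] -> (j <= b)%N by move/asboolP/Ab.
by case: (ex_maxnP Pk Pb) => m /asboolP Am mM; exists m; split=> // j Aj;
  apply: mM; apply/asboolP.
Qed.

Definition parabola (x : R) : plane :=
  \row_(c < 2) (if c == 0 then x else x ^+ 2).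

Lemma convex_family_parabola n :
  convex_family (fun i : 'I_n => (parabola i.*2%:R, parabola i.*2.+1%:R)).
Proof.
split=> [i j ij|[i b] w w0 wi w1].
  apply/seteqP; split=> // z [[s /= /andP[s0 s1] <-] [t /= /andP[t0 t1]]].
  move=> /(congr1 (fun z : plane => z 0 0)).
  have natS k : k.+1%:R = k%:R + 1 :> R by rewrite natr1.
  rewrite !mxE /= !natS => E.
  have [lij|lji] := ltnP i j.
    have : (i.*2.+2%:R <= j.*2%:R :> R) by rewrite ler_nat; lia.
    by rewrite !natS; lra.
  have : (j.*2.+2%:R <= i.*2%:R :> R).
    by rewrite ler_nat; move: ij lji; rewrite -val_eqE /=; lia.
  by rewrite !natS; lra.
pose X (jb : 'I_n * bool) : R := (jb.1.*2 + jb.2)%:R.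
pose S : seg_family n := fun i => (parabola i.*2%:R, parabola i.*2.+1%:R).
rewrite -/S.
have SE jb : endpoint S jb = parabola (X jb).
  by case: jb => j [] //=; rewrite /endpoint /X /= ?addn1 ?addn0.
move=> E.
have Ex : \sum_jb w jb * X jb = X (i, b).
  move: (congr1 (fun z : plane => z 0 0) E); rewrite SE mxE /= => <-.
  by rewrite summxE; apply: eq_bigr => jb _; rewrite SE !mxE.
have Ey : \sum_jb w jb * X jb ^+ 2 = X (i, b) ^+ 2.
  move: (congr1 (fun z : plane => z 0 1) E); rewrite SE mxE /= => <-.
  by rewrite summxE; apply: eq_bigr => jb _; rewrite SE !mxE.
have E0 : \sum_jb w jb * (X jb - X (i, b)) ^+ 2 = 0.
  transitivity (\sum_jb (w jb * X jb ^+ 2 -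
      (X (i, b) *+ 2) * (w jb * X jb) + X (i, b) ^+ 2 * w jb)).
    by apply: eq_bigr => jb _; ring.
  by rewrite big_split sumrB -!mulr_sumr Ex Ey w1 /=; ring.
have wz jb : w jb = 0.
  have [->|ne] := eqVneq jb (i, b); first by [].
  have /psumr_eq0P : forall jb, true -> 0 <= w jb * (X jb - X (i, b)) ^+ 2.
    by move=> ? _; rewrite mulr_ge0 ?sqr_ge0.
  move=> /(_ E0 jb isT) /eqP; rewrite mulf_eq0 sqrf_eq0 => /orP[/eqP //|].
  rewrite subr_eq0 eqr_nat => /eqP h; case/eqP: ne.
  case: jb h => j c /= h; congr (_, _).
    by apply: val_inj => /=; case: (b) (c) h => [] []; lia.
  by case: (b) (c) h => [] []; lia.
by move: w1; under eq_bigr do rewrite wz; rewrite big1 // => /eqP;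
  rewrite eq_sym oner_eq0.
Qed.

Lemma num_visited_le n (S : seg_family n) v : (num_visited S v <= n)%N.
Proof. by rewrite (leq_trans (max_card _)) ?card_ord. Qed.

Lemma endpoints_neq n (S : seg_family n) (j : 'I_n) :
  convex_family S -> (S j).1 <> (S j).2.
Proof.
move=> [_ cS] E.
have h := cS (j, true) (fun ib => (ib == (j, false))%:R).
apply: h => [ib|||].
- exact: ler0n.
- by rewrite xpair_eqE eqxx.
- rewrite (bigD1 (j, false)) //= eqxx big1 ?addr0 // => ib /negbTE -> //.
- rewrite (bigD1 (j, false)) //= eqxx scale1r big1 ?addr0 // => ib /negbTE ->.
  by rewrite scale0r.
Qed.

Lemma q_set1 n : q_set n.+1 1%N.
Proof.
move=> S cS; pose a := (S ord0).1; pose b := (S ord0).2.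
have ab : a <> b by exact: endpoints_neq.
have inj j i : (i.+1 < 2)%N -> is_member S [:: a; b] i j -> j = ord0.
  case: i => // _ h; apply: contrapT => /eqP /(cS.1 j ord0).
  have seg1 (x y : plane) : segment x y x.
    by exists 0 => /=; rewrite ?lexx ?ler01 // subr0 scale1r scale0r addr0.
  have seg2 (x y : plane) : segment x y y.
    by exists 1 => /=; rewrite ?lexx ?ler01 // subrr scale1r scale0r add0r.
  rewrite -/a -/b -subset0 => /(_ a); apply; split; last exact: seg1.
  by case: h => ->; [exact: seg1|exact: seg2].
have m0 : is_member S [:: a; b] 0 ord0 by left; rewrite /a /b /=; case: (S _).
exists [:: a; b]; first split; first split.
- by split=> // [[|i]|] // i [|[|j]].
- exists false => -[|i] // _; split=> // _; by exists ord0.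
- move=> j nj [|i] // _ [z []] /=.
  have /(cS.1 j ord0) : j != ord0.
    by apply: contra_notN nj => /eqP ->; exists 0%N.
  have sub x y : open_segment x y `<=` segment x y.
    by move=> ? [t /= /andP[t0 t1] <-]; exists t => //=; rewrite !ltW.
  by rewrite -subset0 => dj /sub z1 /sub z2; apply: (dj z).
- rewrite /num_visited (_ : [set _ | _]%SET = [set ord0]%SET) ?cards1 //.
  apply/setP => j; rewrite !inE; apply/asboolP/eqP => [[i]|->]; first exact: inj.
  by exists 0%N.
Qed.

Lemma q_set_sub_p_set n : q_set n `<=` p_set n.
Proof. by move=> k h S /h [v [av _] vk]; exists v. Qed.

Lemma p_set_le n j : p_set n j -> (j <= n)%N.
Proof.
by move=> /(_ _ (convex_family_parabola n)) [v _ <-]; exact: num_visited_le.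
Qed.

Lemma p_spec n : (0 < n)%N -> is_max (p_set n) (p n).
Proof.
case: n => // n _.
exact: is_maxP (q_set_sub_p_set (@q_set1 n)) (@p_set_le n.+1).
Qed.

Lemma q_spec n : (0 < n)%N -> is_max (q_set n) (q n).
Proof.
case: n => // n _; apply: is_maxP (@q_set1 n) _.
by move=> j /q_set_sub_p_set; exact: p_set_le.
Qed.

End Segments.

Record graph := Graph {
  vertex :> finType;
  adj : rel vertex;
  adj_sym : symmetric adj;
  adj_irr : irreflexive adj }.

Definition edges (G : graph) : {set {set G}} :=
  [set [set xy.1; xy.2] | xy in [pred xy : G * G | adj xy.1 xy.2]]%SET.

Definition num_edges (G : graph) : nat := #|edges G|.

(* The cycles excluded are those with at least three distinct vertices, as a
   single edge traversed back and forth is a ucycle of size 2. *)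
Definition is_tree (G : graph) : Prop :=
  [/\ (0 < #|G|)%N,
      forall x y : G, connect (@adj G) x y
    & forall c : seq G, ucycle (@adj G) c -> (size c <= 2)%N].

Section Induced.
Variables (G : graph) (A : {set G}).
Definition induced_adj : rel {x : G | x \in A} := fun x y => adj (val x) (val y).
Lemma induced_sym : symmetric induced_adj.
Proof. by move=> x y; exact: adj_sym. Qed.
Lemma induced_irr : irreflexive induced_adj.
Proof. by move=> x; exact: adj_irr. Qed.
Definition induced : graph := Graph induced_sym induced_irr.
End Induced.

Definition remove_vertices (G : graph) (X : {set G}) : graph :=
  induced (~: X)%SET.

(* The edge uv is contracted into u: v is deleted and u inherits its
   neighbours. *)
Section Contract.
Variables (G : graph) (u v : G).
Definition contract_adj : rel {x : G | x != v} := fun x y =>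
  (val x != val y) &&
  [|| adj (val x) (val y), (val x == u) && adj v (val y)
    | (val y == u) && adj v (val x)].
Lemma contract_sym : symmetric contract_adj.
Proof.
move=> x y; rewrite /contract_adj eq_sym adj_sym; congr (_ && (_ || _)).
exact: orbC.
Qed.
Lemma contract_irr : irreflexive contract_adj.
Proof. by move=> x; rewrite /contract_adj eqxx. Qed.
Definition contract : graph := Graph contract_sym contract_irr.
End Contract.

Inductive contracts_to : graph -> graph -> Prop :=
| contracts_refl (G : graph) : contracts_to G G
| contracts_step (G H : graph) (u v : G) :
    adj u v -> contracts_to (contract u v) H -> contracts_to G H.

Definition is_path_graph (G : graph) : Prop :=
  exists s : seq G, [/\ uniq s, (forall x, x \in s)
    & forall x y, adj x y =
        ((index x s).+1 == index y s) || ((index y s).+1 == index x s)].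

Definition leaf (G : graph) (x : G) : bool := #|[set y | adj x y]%SET| == 1%N.

Definition is_caterpillar (G : graph) : Prop :=
  is_tree G /\ is_path_graph (induced [set x : G | ~~ leaf x]%SET).

Definition contraction_set (m : nat) : set nat :=
  [set k | forall T : graph, is_tree T -> num_edges T = m ->
     exists H, [/\ contracts_to T H, is_caterpillar H & num_edges H = k]].

Definition removal_set (m : nat) : set nat :=
  [set k | forall T : graph, is_tree T -> num_edges T = m ->
     exists X : {set T}, is_caterpillar (remove_vertices X) /\
       num_edges (remove_vertices X) = k].

(* Main.v *)
Require Import Defs.
From mathcomp Require Import all_boot all_order all_algebra.
From mathcomp Require Import boolp classical_sets reals.
From mathcomp Require Import ring lra zify.

Set Implicit Arguments.
Unset Strict Implicit.
Unset Printing Implicit Defensive.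

Import Order.TTheory GRing.Theory Num.Theory.

(** Cut the circle at some point: noncrossing chords become nested brackets,
whose nesting tree is the dual tree of the family, chords being edges. Deleting
chords contracts edges. A chord d separates two chords a and b when exactly one
of them lies inside d, and two edges of the tree are adjacent iff no other edge
separates them. The chords visited by an alternating path, in order, thus form
a walk through adjacent edges (of the contracted tree, or of the tree itself if
the path is compatible), and a tree all of whose edges are listed by such a walk
is a caterpillar.

Conversely, cut the circle at the end of a chord dual to a pendant edge c at an
end of the spine of a caterpillar. Then the chords having another chord inside
them are pairwise nested, so that the leftmost chord is empty, or the rightmost
chord is empty, or the outermost chord encloses all the others. Removing such a
chord over and over lists the endpoints so that each one is extreme among those
that follow, which makes the polygonal chain simple. *)

(** * Bracket systems and their trees *)

(** No planar topology is used: a bracket other than the outermost stands at once for a vertex and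
    for the edge to its parent, so separation of edges is a comparison of numbers. Not only the
    maxima agree: every positive [k] attained on one side is attained on the other. Each tree yields
    one family, its brackets being drawn as chords of a parabola, and each family yields one tree,
    after an outer bracket is added for the unbounded region.

    The two parts of the theorem differ only in the chords that may separate successive visited
    ones. A connecting segment of a chain crosses every separating chord; simplicity forbids this
    for visited chords, compatibility for the others.

    The obstacle is the cut. Nesting depends on it, and listing the endpoints requires a cut at an
    end of [c], which is known only once the caterpillar is. The property required of [c] is
    therefore phrased by comparing sides of chords: whether two endpoints lie on the same side of a
    chord is a matter of signs of areas and survives a change of cut. *)

Section Brackets.
Variables (E : finType) (l r : E -> nat).
Implicit Types (a b c p t : E) (A B : {set E}).

Definition inside x y := (l y < l x) && (r x < r y).

(** The strict inequalities keep endpoints of different brackets distinct, so that they can serve as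
    ranks of points in convex position. *)
Definition laminar A :=
  (forall x, x \in A -> l x < r x) /\
  (forall x y, x \in A -> y \in A -> x != y ->
     [|| r x < l y, r y < l x, inside x y | inside y x]).

(** The parent relation of the nesting forest of [A]. *)
Definition cov A x y :=
  inside x y && [forall z in A, ~~ (inside x z && inside z y)].

(** Here [y] is read as the edge to its parent: deleting it leaves two components, and the boolean
    tells which one contains the vertex [x]. For [x] different from [y] it also locates the edge
    [x]. *)
Definition side y x := (x == y) || inside x y.

Definition unsep A x y :=
  [forall z in A, (z != x) && (z != y) ==> (inside x z == inside y z)].

Lemma inside_trans : transitive inside.
Proof. by move=> y x z; rewrite /inside; lia. Qed.

Lemma insidexx x : inside x x = false.
Proof. by rewrite /inside; lia. Qed.

Lemma inside_asym x y : inside x y -> inside y x = false.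
Proof. by rewrite /inside; lia. Qed.

Lemma inside_neq x y : inside x y -> x != y.
Proof. by apply: contraTneq => ->; rewrite insidexx. Qed.

Lemma laminarS A B : B \subset A -> laminar A -> laminar B.
Proof.
move=> /fintype.subsetP BA [h1 h2]; split=> [x /BA /h1 //|x y /BA xA /BA yA]; exact: h2.
Qed.

Lemma laminar_chain A x y z : laminar A -> x \in A -> y \in A -> z \in A ->
  inside x y -> inside x z -> [\/ y = z, inside y z | inside z y].
Proof.
move=> [h1 h2] xA yA zA xy xz; have [->|yz] := eqVneq y z; first by constructor 1.
have := h1 _ xA; have := h1 _ yA; have := h1 _ zA.
case/or4P: (h2 _ _ yA zA yz) => h; last 2 first.
- by constructor 2.
- by constructor 3.
- by move: xy xz; rewrite /inside; lia.
- by move: xy xz; rewrite /inside; lia.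
Qed.

Lemma covP A x y : reflect (inside x y /\
  forall z, z \in A -> inside x z -> inside z y -> False) (cov A x y).
Proof.
apply: (iffP andP) => [[xy /forall_inP h]|[xy h]]; split=> //.
  by move=> z /h /negP k xz zy; apply: k; rewrite xz.
by apply/forall_inP => z zA; apply/negP => /andP[]; apply: h.
Qed.

Lemma cov_inside A x y : cov A x y -> inside x y.
Proof. by case/andP. Qed.

Lemma cov_uniq A x y z : laminar A -> x \in A -> y \in A -> z \in A ->
  cov A x y -> cov A x z -> y = z.
Proof.
move=> lA xA yA zA /covP[xy hy] /covP[xz hz].
by case: (laminar_chain lA xA yA zA xy xz) => // h; [case: (hz y)|case: (hy z)].
Qed.

Lemma cov_ex A x y : laminar A -> x \in A -> y \in A -> inside x y ->
  exists2 p, p \in A & cov A x p.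
Proof.
move=> lA xA yA xy.
case: (@arg_minnP _ y [pred p | (p \in A) && inside x p] (fun p => r p - l p)).
  by rewrite /= yA.
move=> p /= /andP[pA xp] pmin; exists p => //; apply/covP; split=> // z zA xz zp.
have := pmin z; rewrite zA xz => /(_ isT).
by have := lA.1 z zA; have := lA.1 p pA; move: zp; rewrite /inside; lia.
Qed.

(** Only the edge [c] leads from one side of [c] to the other: a bracket around [x] but neither
    equal to nor around its parent [y] would lie strictly between them. *)
Lemma cov_side A c x y : laminar A -> c \in A -> x \in A -> y \in A ->
  cov A x y -> x != c -> side c x = side c y.
Proof.
move=> lA cA xA yA /covP[xy h] xc; rewrite /side (negbTE xc) /=.
apply/idP/orP => [xc'|[/eqP <- //|]]; last exact: inside_trans.
case: (laminar_chain lA xA cA yA xc' xy) => [->|cy|yc]; [by left| |by right].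
by case: (h c).
Qed.

Lemma side_cov A x y : cov A x y -> side x y = false.
Proof.
move=> /cov_inside xy; rewrite /side inside_asym // orbF.
by rewrite eq_sym (negbTE (inside_neq xy)).
Qed.

Lemma sidexx x : side x x.
Proof. by rewrite /side eqxx. Qed.

(** Deleting the bracket [c] contracts the edge above it: the children of [c] pass to its parent. *)
Lemma cov_rem A c x y : laminar A -> c \in A -> x \in A -> y \in A ->
  x != c -> y != c ->
  cov (A :\ c) x y = cov A x y || (cov A x c && cov A c y).
Proof.
move=> lA cA xA yA xc yc; apply/covP/idP => [[xy h]|].
  have [//|n] := boolP (cov A x y).
  have [z [zA xz zy]] : exists z, [/\ z \in A, inside x z & inside z y].
    move: n; rewrite /cov xy /= negb_forall => /existsP[z].
    by rewrite negb_imply negbK => /and3P[? ? ?]; exists z.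
  have zc : z = c.
    by apply/eqP/negPn/negP => zc; apply: (h z) => //; rewrite !inE zc.
  subst z => /=; apply/andP; split; apply/covP; split=> // z z1 z2 z3.
    apply: (h z) => //; last exact: inside_trans zy.
    by rewrite !inE z1 (inside_neq z3).
  apply: (h z) => //; last exact: inside_trans z2.
  by rewrite !inE z1 eq_sym (inside_neq z2).
case/orP => [/covP[xy h]|/andP[/covP[xc' h1] /covP[cy h2]]]; split=> //.
- by move=> z; rewrite !inE => /andP[_]; apply: h.
- exact: inside_trans cy.
- move=> z; rewrite !inE => /andP[zc zA] xz zy.
  case: (laminar_chain lA xA cA zA xc' xz) => [e|cz|zc'].
  + by rewrite e eqxx in zc.
  + exact: (h2 z).
  + exact: (h1 z).
Qed.

(* The brackets of A, with the outermost bracket t, form the rooted tree G. *)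
Record models (G : graph) (phi : G -> E) A t : Prop := Models {
  mod_lam : laminar A;
  mod_inj : injective phi;
  mod_in : forall u, phi u \in A;
  mod_sur : forall a, a \in A -> exists u, phi u = a;
  mod_topA : t \in A;
  mod_top : forall a, a \in A -> a != t -> inside a t;
  mod_adj : forall u v, adj u v = cov A (phi u) (phi v) || cov A (phi v) (phi u)
}.

Section Models.
Variables (G : graph) (phi : G -> E) (A : {set E}) (t : E).
Hypothesis mG : models phi A t.
Let lA := mod_lam mG.
Implicit Types (u v w : G).

Lemma models_cov u v w : cov A (phi u) (phi v) -> cov A (phi u) (phi w) -> v = w.
Proof.
move=> h1 h2; apply: (mod_inj mG).
exact: (cov_uniq lA (mod_in mG u) (mod_in mG v) (mod_in mG w)).
Qed.

Lemma models_adj_side c u v : c \in A -> adj u v -> phi u != c -> phi v != c ->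
  side c (phi u) = side c (phi v).
Proof.
move=> cA; rewrite (mod_adj mG) => /orP[] h uc vc; last apply/esym.
  exact: (cov_side lA cA (mod_in mG u) (mod_in mG v)).
exact: (cov_side lA cA (mod_in mG v) (mod_in mG u)).
Qed.

Lemma models_parent a : a \in A -> a != t ->
  exists u v, [/\ phi u = a, cov A a (phi v) & adj u v].
Proof.
move=> aA at'; have [p pA ap] := cov_ex lA aA (mod_topA mG) (mod_top mG aA at').
have [u ua] := mod_sur mG aA; have [v vp] := mod_sur mG pA.
by exists u, v; rewrite vp (mod_adj mG) ua vp ap.
Qed.

Lemma models_top_cov u : cov A t (phi u) = false.
Proof.
apply/negP => /cov_inside h; have [e|/(mod_top mG (mod_in mG u))] := eqVneq (phi u) t.
  by rewrite e insidexx in h.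
by move=> /inside_asym; rewrite h.
Qed.

Lemma models_tree : is_tree G.
Proof.
have [x0 x0t] := mod_sur mG (mod_topA mG).
split; first by apply/card_gt0P; exists x0.
  (* Widths increase towards the root, so the induction is on the width that [x] lacks. *)
  have conn0 n x : r t - l t - (r (phi x) - l (phi x)) <= n ->
      connect (@adj G) x x0.
    elim: n x => [|n IH] x hx; have [e|ne] := eqVneq (phi x) t.
    - by rewrite -x0t in e; rewrite (mod_inj mG e) connect0.
    - have := mod_top mG (mod_in mG x) ne; rewrite /inside.
      by have := lA.1 _ (mod_in mG x); lia.
    - by rewrite -x0t in e; rewrite (mod_inj mG e) connect0.
    - have [u [v [ux xv uv]]] := models_parent (mod_in mG x) ne.
      rewrite -(mod_inj mG ux) in xv *.
      apply: (connect_trans (connect1 uv)); apply: IH.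
      have := mod_top mG (mod_in mG u); rewrite (mod_inj mG ux) => /(_ ne).
      have := cov_inside xv; rewrite /inside (mod_inj mG ux).
      have := lA.1 _ (mod_in mG x); have := lA.1 _ (mod_in mG v).
      have [->|/(mod_top mG (mod_in mG v))] := eqVneq (phi v) t; first by lia.
      by rewrite /inside; lia.
  move=> x y; apply: (connect_trans (conn0 _ x (leqnn _))).
  by rewrite (sym_connect_sym (@adj_sym G)) (conn0 _ y (leqnn _)).
move=> c uc; rewrite leqNgt; apply/negP => c3.
have [x1 x1c] : exists x, x \in c by case: c c3 {uc} => // x c; exists x; rewrite mem_head.
(* Both neighbours on the cycle of its narrowest bracket must be the parent of that bracket, hence
   coincide. *)
case: (@arg_minnP _ x1 [in c] (fun x => r (phi x) - l (phi x)) x1c) => x xc xmin.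
have [i c' ec] := rot_to xc.
have uc' : ucycle (@adj G) (x :: c') by rewrite -ec rot_ucycle.
have sc' : size (x :: c') = size c by rewrite -ec size_rot.
have up y : y \in c' -> adj x y -> cov A (phi x) (phi y).
  rewrite (mod_adj mG) => yc /orP[//|/cov_inside yx].
  have : y \in c by rewrite -(mem_rot i) ec inE yc orbT.
  move=> /xmin; have := lA.1 _ (mod_in mG x); have := lA.1 _ (mod_in mG y).
  by move: yx; rewrite /inside; lia.
case: c' {ec} sc' uc' up => [|y c']; first by case: (c) c3 => // ? [].
elim/last_ind: c' => [|c' z _] /=; first by move: c3 => /[swap] <-.
move=> _ /andP[/= /andP[xy]].
rewrite rcons_path last_rcons => /andP[_ zx] /andP[_ /andP[yz _]] up.
have e : y = z.
  apply: (@models_cov x); apply: up; rewrite ?mem_head //.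
    by rewrite inE mem_rcons mem_head orbT.
  by rewrite adj_sym.
by rewrite e mem_rcons mem_head in yz.
Qed.

(** The edge from [a] to its parent. For the outermost [t] this is a singleton, so edges are indexed
    by [A :\ t]. *)
Definition edge_of a : {set G} := [set x | (phi x == a) || cov A a (phi x)].

Lemma edge_ofE u v : cov A (phi u) (phi v) -> edge_of (phi u) = [set u; v].
Proof.
move=> uv; apply/setP => w; rewrite !inE (inj_eq (mod_inj mG)); congr orb.
by apply/idP/eqP => [uw|->//]; apply: (models_cov uw uv).
Qed.

Lemma edges_models : edges G = [set edge_of a | a in A :\ t].
Proof.
apply/setP => e; apply/imsetP/imsetP => [[[u v]]|[a]].
  rewrite inE /= => uv ->; move: (uv); rewrite (mod_adj mG) => /orP[] h.
    exists (phi u); last by rewrite (edge_ofE h).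
    rewrite !inE (mod_in mG) andbT; apply: contraTneq h => ->.
    by rewrite models_top_cov.
  exists (phi v); last by rewrite (edge_ofE h) finset.setUC.
  rewrite !inE (mod_in mG) andbT; apply: contraTneq h => ->.
  by rewrite models_top_cov.
rewrite !inE => /andP[at' aA] ->.
have [u [v [ua av uv]]] := models_parent aA at'.
by exists (u, v); rewrite ?inE //= -ua (@edge_ofE u v) // ua.
Qed.

(** Two brackets with the same edge would be parents of each other. *)
Lemma edge_of_inj : {in A :\ t &, injective edge_of}.
Proof.
move=> a b; rewrite !inE => /andP[at' aA] /andP[bt bA].
have [u [v [ua av uv]]] := models_parent aA at'.
have [u' [v' [ub bv _]]] := models_parent bA bt.
rewrite -ua -ub in av bv *; rewrite (edge_ofE av) (edge_ofE bv) => e.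
have [->//|ne] := eqVneq u u'.
have : u \in [set u'; v'] by rewrite -e !inE eqxx.
have : u' \in [set u; v] by rewrite e !inE eqxx.
rewrite !inE eq_sym (negbTE ne) /= => /eqP e1 /eqP e2; move: av bv.
by rewrite -e1 e2 => /cov_inside /inside_asym h /cov_inside; rewrite h.
Qed.

Lemma models_num_edges : num_edges G = #|A|.-1.
Proof.
rewrite /num_edges edges_models card_in_imset; last exact: edge_of_inj.
by rewrite (cardsD1 t A) (mod_topA mG).
Qed.

End Models.

End Brackets.

(** * Contracting edges amounts to deleting brackets *)

Section Contraction.
Variables (E : finType) (l r : E -> nat).
Implicit Types (a b c p t : E) (A B : {set E}).
Local Notation inside := (inside l r).
Local Notation cov := (cov l r).
Local Notation models := (models l r).

(** The bracket to delete is that of the child [c], whereas [contract] deletes the vertex [v]. When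
    [v] is the parent, the surviving child takes over the bracket of the parent; hence the test on
    [u]. *)
Lemma models_contract_aux (G : graph) (phi : G -> E) A t (u v c p : G) :
  models phi A t -> cov A (phi c) (phi p) ->
  (u, v) = (p, c) \/ (u, v) = (c, p) ->
  models (fun x : contract u v => phi (if val x == u then p else val x))
    (A :\ phi c) t.
Proof.
move=> mG cp uv.
have cnp : c != p.
  by apply: contraTneq cp => ->; apply/negP => /cov_inside; rewrite insidexx.
have ct : phi c != t.
  by apply: contraTneq cp => ->; rewrite (models_top_cov mG).
pose vl (x : contract u v) : G := val x.
have adjE (x y : contract u v) : adj x y = (vl x != vl y) &&
  [|| adj (vl x) (vl y), (vl x == u) && adj v (vl y)
    | (vl y == u) && adj v (vl x)] by [].
have vv x : vl x != v by exact: (valP x).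
have vinj : injective vl by exact: val_inj.
have vsur y : y != v -> exists x, vl x = y by move=> yv; exists (Sub y yv).
rewrite -[X in models X]/(fun x => phi (if vl x == u then p else vl x)).
clearbody vl.
pose f x : G := if vl x == u then p else vl x.
have fc x : f x != c.
  rewrite /f; case: ifPn => [_|xu]; first by rewrite eq_sym.
  by case: uv xu => -[eu ev]; [rewrite -ev => _; apply: vv|rewrite -eu].
have finj : injective f.
  have pv z : vl z = p -> vl z = u.
    by case: uv => -[eu ev]; rewrite ?eu // => zp; case/eqP: (vv z); rewrite ev.
  move=> x y; rewrite /f => e; apply: vinj; move: e.
  case: eqP => [->|nx]; case: eqP => [->|ny] // h.
    by case: ny; apply: pv.
  by case: nx; apply: pv.
have fsur y : y != c -> exists x, f x = y.
  move=> yc; have [e|ne] := eqVneq y p.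
    have uvn : u != v by case: uv => -[-> ->] //; rewrite eq_sym.
    by have [x xu] := vsur _ uvn; exists x; rewrite /f xu eqxx.
  have yv : y != v by case: uv => -[_ ->].
  have [x xy] := vsur _ yv; exists x; rewrite /f xy; case: eqP => // e.
  by case: uv yc ne => -[<- _]; rewrite e eqxx.
(* Seen through [f], both cases become one: the parent inherits the neighbours of the child. *)
have fadj x y : adj x y = (f x != f y) &&
    [|| adj (f x) (f y), (f x == p) && adj c (f y) | (f y == p) && adj c (f x)].
  rewrite adjE (inj_eq finj) (inj_eq vinj).
  have [//|ne /=] := eqVneq x y.
  case: uv => -[eu ev]; rewrite /f.
    have e z : (if vl z == u then p else vl z) = vl z.
      by case: eqP => // ->.
    by rewrite !e eu ev.
  have vp z : vl z != p by rewrite -ev.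
  have : ~~ ((vl x == u) && (vl y == u)).
    by apply: contra ne => /andP[/eqP a /eqP b]; apply/eqP/vinj; rewrite a b.
  case: (eqVneq (vl x) u) => [xu|xu]; case: (eqVneq (vl y) u) => [yu|yu] //= _.
  - by rewrite eqxx (negbTE (vp y)) /= !orbF xu eu ev orbC.
  - rewrite eqxx (negbTE (vp x)) /= yu eu ev ![adj _ (vl x)]adj_sym.
    by rewrite [adj (vl x) c]adj_sym orbC.
  - by rewrite (negbTE (vp x)) (negbTE (vp y)) /= !orbF.
have lA := mod_lam mG.
split=> //.
- by apply: laminarS lA; apply: subD1set.
- by move=> x y /(mod_inj mG) /finj.
- move=> x; rewrite !inE (mod_in mG) andbT (inj_eq (mod_inj mG)); exact: fc.
- move=> a; rewrite !inE => /andP[ac aA]; have [y ya] := mod_sur mG aA.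
  have [|x xy] := fsur y; first by apply: contraNneq ac => <-; rewrite ya.
  by exists x; rewrite -/(f x) xy.
- by rewrite !inE eq_sym ct (mod_topA mG).
- by move=> a; rewrite !inE => /andP[_]; apply: (mod_top mG).
move=> x y; rewrite fadj -!/(f _).
have cin := mod_in mG; have cinj := inj_eq (mod_inj mG).
rewrite !(cov_rem lA) ?cin ?cinj ?fc //.
have covc z : cov A (phi c) (phi z) = (z == p).
  by apply/idP/eqP => [h|-> //]; apply: (models_cov mG h cp).
rewrite !(mod_adj mG) !covc.
have [->|ne /=] := eqVneq (f x) (f y).
  have n z : cov A (phi z) (phi z) = false.
    by apply/negP => /cov_inside; rewrite insidexx.
  rewrite n /= orbb; apply/esym/negP => /andP[h /eqP e].
  by move: h cp; rewrite e => /cov_inside /inside_asym h /cov_inside; rewrite h.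
have [e|] := eqVneq (f x) p; have [e'|] := eqVneq (f y) p => //=.
- by rewrite e e' eqxx in ne.
- by rewrite ?orbF ?andbT ?andbF ?orbF orbA.
- by rewrite ?orbF ?andbT ?andbF ?orbF orbAC.
- by rewrite ?andbF ?orbF.
Qed.

Lemma models_contracts_to (G H : graph) (phi : G -> E) A t :
  models phi A t -> contracts_to G H ->
  exists (psi : H -> E) B, models psi B t.
Proof.
move=> mG GH; elim: GH phi A mG => [{}G|{}G {}H u v uv _ IH] phi A mG.
  by exists phi, A.
move: uv; rewrite (mod_adj mG) => /orP[] h.
  by apply: (IH _ _ (models_contract_aux mG h (or_intror erefl))).
by apply: (IH _ _ (models_contract_aux mG h (or_introl erefl))).
Qed.

(** Brackets of [A :\: B] are removed one at a time; none is outermost, so each has an edge to a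
    parent that can be contracted. *)
Lemma contracts_to_models (G : graph) (phi : G -> E) A B t :
  models phi A t -> B \subset A -> t \in B ->
  exists (H : graph) (psi : H -> E), contracts_to G H /\ models psi B t.
Proof.
move: {2}#|A :\: B|%N (leqnn #|A :\: B|) => n.
elim: n G phi A => [|n IH] G phi A hn mG BA tB;
  have [e|[c cAB]] := set_0Vmem (A :\: B).
- exists G, phi; split; first exact: contracts_refl.
  by rewrite (_ : B = A) //; apply/eqP; rewrite finset.eqEsubset BA -finset.setD_eq0 e eqxx.
- by move: hn; rewrite (cardD1 c) cAB.
- exists G, phi; split; first exact: contracts_refl.
  by rewrite (_ : B = A) //; apply/eqP; rewrite finset.eqEsubset BA -finset.setD_eq0 e eqxx.
move: (cAB); rewrite !inE => /andP[cB cA].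
have ct : c != t by apply: contraNneq cB => ->.
have [u [v [uc cv uv]]] := models_parent mG cA ct.
rewrite -uc in cv.
have mC := models_contract_aux mG cv (or_introl erefl).
have [|||H [psi [cH mH]]] := IH _ _ _ _ mC.
- rewrite -ltnS (leq_trans _ hn) // [X in _ < X](cardsD1 c) cAB ltnS.
  by apply/subset_leq_card/fintype.subsetP => x; rewrite uc !inE => /and3P[-> -> ->].
- by rewrite finset.subsetD1 BA uc cB.
- by [].
- by exists H, psi; split=> //; apply: contracts_step cH; rewrite adj_sym.
Qed.

End Contraction.

(** * The bracket system of a tree *)

Section Growth.
Variable T : graph.
Hypothesis treeT : is_tree T.

(** Invariant of the growth of a bracketed part [A] of [T]. Connectivity inside [A] is kept because
    it turns a second neighbour in [A] of a new vertex into a cycle. *)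
Let good (A : {set T}) (l r : T -> nat) t := [/\ laminar l r A, t \in A,
  (forall a, a \in A -> a != t -> inside l r a t),
  (forall x y, x \in A -> y \in A -> adj x y = cov l r A x y || cov l r A y x)
  & (forall a, a \in A ->
       connect [rel x y | [&& adj x y, x \in A & y \in A]] t a)].

(** Tripling all coordinates frees the two places just after the left end of [a], enough for the
    bracket of a new vertex [b] attached to [a]. *)
Let grow A l r t : good A l r t -> A != [set: T] ->
  exists A' l' r', good A' l' r' t /\ #|A| < #|A'|.
Proof.
move=> [lA tA top ad co] AT.
have [_ conn acyc] := treeT.
have [a [b [aA bA ab]]] : exists a b, [/\ a \in A, b \notin A & adj a b].
  have [b bA] : exists b, b \notin A.
    move: AT; rewrite -finset.subTset => /subsetPn[b _ bA]; by exists b.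
  have /connectP[s st eb] := conn t b; move: bA; rewrite {}eb.
  elim: s t tA st {top co} => [|y s IH] t tA /=; first by rewrite tA.
  move=> /andP[ty ys]; have [yA|yA] := boolP (y \in A); first exact: IH.
  by exists t, y.
pose e := [rel x y | [&& adj x y, x \in A & y \in A]].
have esym : connect_sym e.
  apply: sym_connect_sym => x y /=; rewrite adj_sym; congr andb; exact: andbC.
have uniqa a' : a' \in A -> adj a' b -> a' = a.
  move=> a'A a'b; apply/eqP/negPn/negP => ne.
  have /connectP[s st es] : connect e a a'.
    by apply: connect_trans (co _ a'A); rewrite esym co.
  case/shortenP: st es => s' st us _ {s} es.
  have sA : all [in A] s'.
    elim: (s') a {aA ab ne us es} st => //= y s IH z /andP[/and3P[_ _ yA] h].
    by rewrite yA (IH _ h).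
  have : ucycle (@adj T) (b :: a :: s').
    apply/andP; split; last first.
      rewrite cons_uniq us andbT inE negb_or; apply/andP; split.
        by apply: contraNneq bA => ->.
      by apply: contra bA => /(allP sA).
    rewrite /= rcons_path adj_sym ab -es a'b andbT /=.
    by apply: sub_path st => x y /and3P[].
  move=> /acyc; case: (s') es => //= e'; by rewrite e' eqxx in ne.
(* b becomes the first child of a. *)
pose l' x := if x == b then (3 * l a).+1 else 3 * l x.
pose r' x := if x == b then (3 * l a).+2 else 3 * r x.
have bE x : x \in A -> (x == b) = false.
  by move=> xA; apply/eqP => e'; rewrite -e' xA in bA.
have insA x y : x \in A -> y \in A -> inside l' r' x y = inside l r x y.
  by move=> xA yA; rewrite /inside /l' /r' !bE //; lia.
have insb x : x \in A -> inside l' r' x b = false.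
  move=> xA; rewrite /inside /l' /r' eqxx !bE //.
  have := lA.1 x xA; have [->|ne] := eqVneq x a; first by lia.
  have := lA.1 a aA; by case/or4P: (lA.2 x a xA aA ne); rewrite /inside; lia.
have bins x : x \in A -> inside l' r' b x = side l r x a.
  move=> xA; rewrite /side /inside /l' /r' eqxx !bE //.
  have := lA.1 x xA; have := lA.1 a aA; have [->|ne] := eqVneq a x; first by lia.
  by case/or4P: (lA.2 a x aA xA ne); rewrite /inside; lia.
have insbb : inside l' r' b b = false by apply: insidexx.
pose A' := b |: A.
have covA x y : x \in A -> y \in A -> cov l' r' A' x y = cov l r A x y.
  move=> xA yA; apply/covP/covP; rewrite insA // => -[xy h]; split=> //.
    by move=> z zA xz zy; apply: (h z); rewrite ?insA // !inE zA orbT.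
  move=> z; rewrite !inE => /orP[/eqP->|zA]; first by rewrite insb.
  by rewrite !insA //; apply: h.
have covb x : x \in A -> cov l' r' A' x b = false.
  by move=> xA; apply/negP => /cov_inside; rewrite insb.
have bcov x : x \in A -> cov l' r' A' b x = (x == a).
  move=> xA; apply/covP/eqP => [[]|->].
    rewrite bins // /side => /orP[/eqP//|ax] h.
    case: (h a); rewrite ?inE ?aA ?orbT ?bins ?sidexx ?insA //.
  split; first by rewrite bins // sidexx.
  move=> z; rewrite !inE => /orP[/eqP->|zA]; first by rewrite insbb.
  rewrite bins // insA // /side => /orP[/eqP <-|az]; first by rewrite insidexx.
  by rewrite (inside_asym az).
exists A', l', r'; split; last by rewrite cardsU1 bA.
split.
- split=> [x|x y]; rewrite !inE.
    move=> /orP[/eqP->|xA]; rewrite /l' /r' ?eqxx ?bE //.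
    by have := lA.1 x xA; lia.
  have lb z : z \in A -> [|| r' b < l' z, r' z < l' b | inside l' r' b z].
    move=> zA; rewrite bins // /l' /r' eqxx bE //; have := lA.1 z zA.
    have := lA.1 a aA; rewrite /side; have [->|ne] := eqVneq a z; first by lia.
    by case/or4P: (lA.2 a z aA zA ne); rewrite /inside; lia.
  move=> /orP[/eqP->|xA] /orP[/eqP->|yA]; rewrite ?eqxx // => ne.
  + by case/or3P: (lb y yA) => ->; rewrite ?orbT.
  + by case/or3P: (lb x xA) => ->; rewrite ?orbT.
  + rewrite !insA // /l' /r' !bE //.
    by case/or4P: (lA.2 x y xA yA ne) => h; rewrite ?h ?orbT //; lia.
- by rewrite !inE tA orbT.
- move=> x; rewrite !inE => /orP[/eqP->|xA] xt; last by rewrite insA ?top.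
  rewrite bins // /side; case: eqP => //= /eqP; exact: top.
- have bb : cov l' r' A' b b = false by apply/negP => /cov_inside; rewrite insbb.
  have badj x : x \in A -> adj x b = (x == a).
    by move=> xA; apply/idP/eqP => [/(uniqa x xA)|->].
  move=> x y; rewrite !inE => /orP[/eqP->|xA] /orP[/eqP->|yA].
  + by rewrite bb adj_irr.
  + by rewrite covb // bcov // adj_sym badj // orbF.
  + by rewrite covb // bcov // badj.
  + by rewrite !covA // ad.
have co' x : x \in A -> connect [rel x y | [&& adj x y, x \in A' & y \in A']] t x.
  move=> xA; apply: connect_sub (co x xA) => y z /= /and3P[yz yA zA].
  by apply: connect1; rewrite /= yz !inE yA zA !orbT.
move=> x; rewrite !inE => /orP[/eqP->|]; last exact: co'.
by apply: connect_trans (co' a aA) (connect1 _); rewrite /= ab !inE eqxx aA !orbT.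
Qed.

Lemma tree_models : exists l r t, models l r (@id T) [set: T] t.
Proof.
have [/card_gt0P[t _] _ _] := treeT.
have : exists A l r, good A l r t.
  exists [set t], (fun=> 0), (fun=> 1).
  have cv z : cov (fun=> 0) (fun=> 1) [set t] z z = false.
    by apply/negP => /cov_inside; rewrite insidexx.
  split=> [|||x y|a]; rewrite ?inE //.
  - by split=> // x y; rewrite !inE => /eqP-> /eqP->; rewrite eqxx.
  - by move=> a; rewrite inE => /eqP->; rewrite eqxx.
  - by move=> /eqP-> /eqP->; rewrite cv adj_irr.
  - by move=> /eqP->; apply: connect0.
move=> [A [l [r gA]]].
move: {2}(#|T| - #|A|)%N (leqnn (#|T| - #|A|)) => n.
have fin A0 l0 r0 : good A0 l0 r0 t -> A0 = [set: T]%SET ->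
    exists l r t, models l r (@id T) [set: T] t.
  move=> [lA tA top ad _] e; subst A0; exists l0, r0, t; split=> //.
    by move=> a _; exists a.
  by move=> u v; apply: ad.
elim: n A l r gA => [|n IH] A l r gA hn; have [e|ne] := eqVneq A [set: T]%SET.
- exact: (fin _ _ _ gA e).
- have [A' [_ [_ [_ h]]]] := grow gA ne.
  by have : #|A'| <= #|T| := max_card _; lia.
- exact: (fin _ _ _ gA e).
- have [A' [l' [r' [gA' h]]]] := grow gA ne.
  by apply: (IH _ _ _ gA'); have : #|A'| <= #|T| := max_card _; lia.
Qed.

End Growth.

(** * Walks through adjacent edges and caterpillars *)

Section Paths.
Variable G : graph.
Implicit Types (x y z w : G) (s : seq G) (e f : {set G}).
Hypothesis acyc : forall c : seq G, ucycle (@adj G) c -> (size c <= 2)%N.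

Lemma acyclic_closing x s : path (@adj G) x s -> uniq (x :: s) ->
  adj (last x s) x -> size s <= 1.
Proof.
move=> xs us lx; rewrite -ltnS; apply: (@acyc (x :: s)); apply/andP; split=> //.
by rewrite /= rcons_path xs.
Qed.

Lemma subpath s x0 i j : sorted (@adj G) s -> uniq s -> i < j < size s ->
  exists q, [/\ path (@adj G) (nth x0 s i) q, last (nth x0 s i) q = nth x0 s j,
    uniq (nth x0 s i :: q), size q = j - i & {subset nth x0 s i :: q <= s}].
Proof.
move=> ss us /andP[ij js]; exists (take (j - i) (drop i.+1 s)).
have e : take (j - i).+1 (drop i s) = nth x0 s i :: take (j - i) (drop i.+1 s).
  by rewrite (drop_nth x0) //=; lia.
have sz : size (take (j - i) (drop i.+1 s)) = j - i.
  by rewrite size_take size_drop; case: ltnP; lia.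
rewrite -e; split=> //.
- have : sorted (@adj G) (take (j - i).+1 (drop i s)).
    by apply/take_sorted/drop_sorted.
  by rewrite e.
- rewrite (last_nth x0) sz -e nth_take // nth_drop; congr nth; lia.
- by apply/take_uniq/drop_uniq.
- by move=> z /mem_take /mem_drop.
Qed.

Lemma path_chord s x0 i j : sorted (@adj G) s -> uniq s -> i < j < size s ->
  adj (nth x0 s i) (nth x0 s j) -> j = i.+1.
Proof.
move=> ss us ij; have [q [pq lq uq sq _]] := subpath x0 ss us ij.
rewrite -lq adj_sym => /(acyclic_closing pq uq); lia.
Qed.

(** The portion of the path between [x] and [y] would close up through [z] into a cycle. *)
Lemma path_ear s x y z : sorted (@adj G) s -> uniq s -> z \notin s ->
  x \in s -> y \in s -> x != y -> adj z x -> adj z y -> False.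
Proof.
move=> ss us zs; wlog ij : x y / index x s < index y s => [H|] xs ys xy zx zy.
  have [h|h|h] := ltngtP (index x s) (index y s).
  - exact: (H x y).
  - by apply: (H y x) => //; rewrite eq_sym.
  - by case/eqP: xy; rewrite -(nth_index x xs) h nth_index.
have [|q [pq lq uq _ qs]] := @subpath s x (index x s) (index y s) ss us.
  by rewrite ij index_mem.
rewrite !nth_index // in pq lq uq qs.
have : size (x :: q) <= 1.
  apply: (@acyclic_closing z); rewrite /= ?zx //.
    by rewrite [X in _ && X]uq andbT; apply: contra zs; apply: qs.
  by rewrite lq adj_sym.
by case: (q) lq => // e; rewrite -e eqxx in xy.
Qed.

Lemma two_nbrs_nonleaf x y z : adj x y -> adj x z -> y != z -> ~~ leaf x.
Proof.
move=> xy xz; apply: contra => /cards1P[w e].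
have : y \in [set z | adj x z]%SET by rewrite inE.
have : z \in [set z | adj x z]%SET by rewrite inE.
by rewrite e !inE => /eqP-> /eqP->.
Qed.

Lemma edgesP e : reflect (exists x y, adj x y /\ e = [set x; y]) (e \in edges G).
Proof.
apply: (iffP imsetP) => [[[x y]]|[x [y [xy ->]]]]; last by exists (x, y).
by rewrite inE /= => xy ->; exists x, y.
Qed.

Lemma edge_at e w : e \in edges G -> w \in e -> exists2 z, adj w z & e = [set w; z].
Proof.
move=> /edgesP[x [y [xy ->]]]; rewrite !inE => /orP[] /eqP->; first by exists y.
by exists x; [rewrite adj_sym|rewrite finset.setUC].
Qed.

Definition meet_edges e f := e :&: f != finset.set0.

(* A walk along the edges e :: es yields a path (in reverse order x :: p) of
   nonleaf vertices meeting all the edges of the walk; y is the end of the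
   current edge e off the path, D is the set of edges already visited. *)
Lemma spine_ex es e x y p (D : {set {set G}}) :
  e \in D -> e = [set x; y]%SET -> adj x y -> y \notin x :: p ->
  path (@adj G) x p -> uniq (x :: p) ->
  (forall h p', p = h :: p' -> [set x; h]%SET \in D) ->
  all (fun z => ~~ leaf z) (x :: p) ->
  (forall d, d \in D -> exists2 z, z \in x :: p & z \in d) ->
  uniq es -> (forall f, f \in es -> f \notin D /\ f \in edges G) ->
  path meet_edges e es ->
  exists s, [/\ sorted (@adj G) s, uniq s, all (fun z => ~~ leaf z) s &
    forall d, (d \in D) || (d \in es) -> exists2 z, z \in s & z \in d].
Proof.
elim: es e x y p D => [|f es IH] e x y p D eD ee xy yp pp up hp lp Dp.
  by move=> _ _ _; exists (x :: p); split=> // d; rewrite orbF => /Dp.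
move=> /= /andP[fes ues] hes /andP[/set0Pn[w /setIP[we wf]] pes].
have [fD fE] := hes f (mem_head _ _).
have [z wz ef] := edge_at fE wf.
have hes' g : g \in es -> g \notin f |: D /\ g \in edges G.
  move=> ges; have [|gD gE] := hes g; first by rewrite inE ges orbT.
  by rewrite !inE negb_or gD andbT; split=> //; apply: contraNneq fes => <-.
have wrap (s : seq G) : (forall d, (d \in f |: D) || (d \in es) ->
    exists2 z, z \in s & z \in d) ->
    forall d, (d \in D) || (d \in f :: es) -> exists2 z, z \in s & z \in d.
  move=> h d hd; apply: h; rewrite !inE; move: hd; rewrite inE.
  by do !case: (_ \in _) => //; rewrite ?orbT ?orbF.
(* If the new edge [f] meets the current one at [x], the path is unchanged; if it meets it at [y],
   the path advances to [y]. *)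
move: we; rewrite ee !inE => /orP[] /eqP ew; rewrite {w wf}ew in wz ef.
  have [||||s [s1 s2 s3 s4]] := IH f x z p (f |: D) _ ef wz _ pp up _ lp _ ues hes' pes.
  - by rewrite !inE eqxx.
  - rewrite inE negb_or; apply/andP; split.
      by apply: contraTneq wz => ->; rewrite adj_irr.
    (* A neighbour [z] of [x] on the path can only be the vertex just after [x], by acyclicity; then
       [f] was already visited. *)
    apply/negP => /splitPr zp; case: p / zp pp up hp lp Dp {IH yp} => p1 p2.
    rewrite -cat_rcons cat_path -cat_cons cat_uniq => /andP[pp _] /and3P[up _ _] hp _ _.
    have := acyclic_closing pp up; rewrite last_rcons adj_sym wz size_rcons => /(_ isT).
    by case: p1 hp {pp up} => // hp _; move: fD; rewrite ef (hp z p2).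
  - by move=> h p' e'; rewrite inE (hp h p' e') orbT.
  - move=> d; rewrite !inE => /orP[/eqP->|/Dp //]; exists x; rewrite ?mem_head //.
    by rewrite ef !inE eqxx.
  by exists s; split=> //; apply: wrap.
have zx : z != x.
  by apply: contraNneq fD => zx; rewrite ef zx finset.setUC -ee.
have [|||||||s [s1 s2 s3 s4]] := IH f y z (x :: p) (f |: D) _ ef wz _ _ _ _ _ _ ues hes' pes.
- by rewrite !inE eqxx.
- rewrite inE negb_or; apply/andP; split.
    by apply: contraTneq wz => ->; rewrite adj_irr.
  rewrite inE negb_or zx /=.
  apply/negP => /splitPr zp; case: p / zp pp up hp lp Dp yp {IH} => p1 p2.
  rewrite -cat_rcons cat_path -cat_cons cat_uniq => /andP[pp _] /and3P[up _ _] _ _ _.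
  rewrite mem_cat negb_or => /andP[yp _].
  have : size (x :: rcons p1 z) <= 1.
    apply: (@acyclic_closing y); rewrite /= ?last_rcons 1?adj_sym ?xy //.
    by rewrite [X in _ && X]up andbT.
  by rewrite /= size_rcons.
- by rewrite /= adj_sym xy.
- by rewrite /= yp.
- by move=> h p' [<- _]; rewrite inE finset.setUC -ee eD orbT.
- rewrite /= in lp; rewrite /= lp andbT.
  by apply: (two_nbrs_nonleaf _ wz (y := x)); rewrite 1?eq_sym // adj_sym.
- move=> d; rewrite !inE => /orP[/eqP->|/Dp [z' z'p z'd]].
    by exists y; rewrite ?mem_head // ef !inE eqxx.
  by exists z'; rewrite // inE z'p orbT.
by exists s; split=> //; apply: wrap.
Qed.

End Paths.

Section Caterpillars.
Variable G : graph.
Hypothesis treeG : is_tree G.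
Implicit Types (x y z w : G) (s : seq G) (e f : {set G}).

Let conn : forall x y, connect (@adj G) x y.
Proof. by case: treeG. Qed.
Let acyc : forall c : seq G, ucycle (@adj G) c -> (size c <= 2)%N.
Proof. by case: treeG. Qed.

Lemma tree_nbr x y : x != y -> exists z, adj x z.
Proof.
move=> xy; have /connectP[[|z s] /= xs e] := conn x y.
  by rewrite e eqxx in xy.
by exists z; case/andP: xs.
Qed.

(** An isolated vertex is not a [leaf] either; the edge [yz] excludes the tree with one vertex. *)
Lemma nonleaf_nbrs x y z : adj y z -> ~~ leaf x ->
  exists a b, [/\ adj x a, adj x b & a != b].
Proof.
move=> yz lx.
have [a xa] : exists a, adj x a.
  have [e|ne] := eqVneq x y; last exact: tree_nbr ne.
  by exists z; rewrite e.
have : 1 < #|[set y | adj x y]%SET|.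
  rewrite ltn_neqAle eq_sym lx; apply/card_gt0P; exists a; by rewrite inE.
by move=> /card_gt1P[b [c [bx cx bc]]]; exists b, c; rewrite !inE in bx cx.
Qed.

(** The path given by [spine_ex] contains every nonleaf vertex: since it meets all edges, two
    neighbours of a vertex off the path would both be on it and form an ear. Acyclicity forbids
    chords of the path. *)
Lemma walk_caterpillar (es : seq {set G}) : 0 < size es -> uniq es ->
  es =i edges G -> sorted (@meet_edges G) es -> is_caterpillar G.
Proof.
move=> es0 ues ees ses; split=> //.
have [s [ss us sl sE]] : exists s, [/\ sorted (@adj G) s, uniq s,
    all (fun z => ~~ leaf z) s &
    forall x, ~~ leaf x -> x \in s].
  case: es es0 ues ees ses => // f1 [_ _ ees _|f2 es _ ues ees ses].
    exists [::]; split=> // x lx; exfalso.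
    have /edgesP[y [z [yz _]]] : f1 \in edges G by rewrite -ees inE.
    have [a [b [xa xb ab]]] := nonleaf_nbrs yz lx.
    have : [set x; a]%SET \in [:: f1] by rewrite ees; apply/edgesP; exists x, a.
    have : [set x; b]%SET \in [:: f1] by rewrite ees; apply/edgesP; exists x, b.
    rewrite !inE => /eqP eb /eqP ea; have : a \in [set x; b]%SET.
      by rewrite eb -ea !inE eqxx orbT.
    rewrite !inE (negbTE ab) orbF.
    by move=> /eqP e; rewrite e adj_irr in xa.
  have f1E : f1 \in edges G by rewrite -ees mem_head.
  have f2E : f2 \in edges G by rewrite -ees !inE eqxx orbT.
  (* The common vertex of the first two edges is not a leaf and starts the spine. *)
  have /= /andP[/set0Pn[w /setIP[w1 w2]] pes] := ses.
  have [y1 wy1 e1] := edge_at f1E w1; have [y2 wy2 e2] := edge_at f2E w2.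
  have ne : y1 != y2.
    by move: ues; apply: contraTneq => e; rewrite e1 e2 e /= inE eqxx.
  have lw : ~~ leaf w by apply: two_nbrs_nonleaf wy1 wy2 ne.
  have [||||||||||s [s1 s2 s3 s4]] := spine_ex acyc (p := [::]) (D := [set f1]%SET)
      (es := f2 :: es) _ e1 wy1.
  - by rewrite inE.
  - by rewrite inE; apply: contraTneq wy1 => ->; rewrite adj_irr.
  - by [].
  - by [].
  - by [].
  - by rewrite /= lw.
  - by move=> d; rewrite inE => /eqP->; exists w; rewrite ?mem_head.
  - by case/andP: ues.
  - move=> f fes; rewrite -ees [f \in _ :: _ :: _]inE fes orbT inE; split=> //.
    by case/andP: ues => h _; apply: contraNneq h => <-.
  - exact: ses.
  exists s; split=> // x lx; apply/negPn/negP => xs.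
  have [a [b [xa xb ab]]] := nonleaf_nbrs wy1 lx.
  have aux c : adj x c -> c \in s.
    move=> xc; have [|z zs] := s4 [set x; c]%SET.
      have : [set x; c]%SET \in f1 :: f2 :: es by rewrite ees; apply/edgesP; exists x, c.
      by rewrite inE !inE.
    by rewrite !inE => /orP[] /eqP e; [rewrite e (negbTE xs) in zs|rewrite -e].
  exact: (path_ear acyc s1 s2 xs (aux a xa) (aux b xb) ab xa xb).
pose N := [set x : G | ~~ leaf x]%SET.
pose s' : seq (induced N) := pmap insub s.
have vs : map val s' = s.
  rewrite pmap_filter; last exact: insubK.
  apply/all_filterP; apply: sub_all sl => x lx; rewrite insubT ?inE //.
exists s'; split.
- by rewrite -(map_inj_uniq val_inj) vs.
- by move=> x; rewrite -(mem_map val_inj) vs sE //; have := valP x; rewrite inE.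
move=> x y; rewrite -!(index_map val_inj) vs.
have inS (z : induced N) : val z \in s.
  by rewrite sE //; have := valP z; rewrite inE.
have xs := inS x; have ys := inS y.
rewrite -[adj x y]/(adj (val x) (val y)).
move: (val x) (val y) xs ys => {}x {}y xs ys.
have adjS u v : u \in s -> v \in s -> (index u s).+1 = index v s -> adj u v.
  move=> us' vs' e; rewrite -(nth_index x us') -(nth_index x vs') -e.
  by apply: (sortedP x _) => //; rewrite e index_mem.
apply/idP/orP => [xy|[]/eqP e].
- have [h|h|h] := ltngtP (index x s) (index y s).
  + left; rewrite eq_sym; apply/eqP; apply: (path_chord acyc (x0 := x) ss us).
      by rewrite h index_mem.
    by rewrite !nth_index.
  + right; rewrite eq_sym; apply/eqP; apply: (path_chord acyc (x0 := x) ss us).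
      by rewrite h index_mem.
    by rewrite !nth_index // adj_sym.
  + by move: xy; rewrite -(nth_index x ys) -h nth_index // adj_irr.
- exact: adjS.
- by rewrite adj_sym adjS.
Qed.

End Caterpillars.

(** Meant for the side of a fixed spine edge, read along the spine: it changes exactly across that
    edge. *)
Lemma single_flip (f : nat -> bool) N k n m :
  (forall j, j.+1 < N -> (f j != f j.+1) = (j == k)) ->
  n <= m -> m < N -> (m <= k) || (k < n) -> f n = f m.
Proof.
move=> kP; elim: m => [|m IH] nm mN mk; first by have -> : n = 0 by lia.
have [->//|ne] := eqVneq n m.+1.
rewrite IH; [|lia|lia|lia].
by apply/eqP; rewrite -[_ == _]negbK kP; lia.
Qed.

(** * Separation of edges and pendant ends of caterpillars *)

Section Separation.
Variables (E : finType) (l r : E -> nat).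
Implicit Types (a b c d p t : E) (A B : {set E}).
Local Notation inside := (inside l r).
Local Notation side := (side l r).
Local Notation cov := (cov l r).
Local Notation models := (models l r).
Local Notation unsep := (unsep l r).

Lemma unsepP A a b : reflect
  (forall d, d \in A -> d != a -> d != b -> inside a d = inside b d) (unsep A a b).
Proof.
apply: (iffP forall_inP) => h d dA.
  by move=> da db; move: (h d dA); rewrite da db => /eqP.
by apply/implyP => /andP[da db]; rewrite (h d).
Qed.

Lemma unsepS A B a b : B \subset A -> unsep A a b -> unsep B a b.
Proof.
by move=> /fintype.subsetP BA /unsepP h; apply/unsepP => d /BA; apply: h.
Qed.

Section Graph.
Variables (G : graph) (phi : G -> E) (A : {set E}) (t : E).
Hypothesis mG : models phi A t.
Let lA := mod_lam mG.

Lemma models_edge_cov u v : adj u v ->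
  cov A (phi u) (phi v) \/ cov A (phi v) (phi u).
Proof. by rewrite (mod_adj mG) => /orP. Qed.

(** Outside the first three cases [p] encloses [b] and [q] encloses [a], so [p] and [q] are
    comparable; if they differed, the inner one would lie between a bracket and its parent. *)
Lemma unsep_parent a b p q : a \in A -> b \in A -> p \in A -> q \in A ->
  unsep A a b -> cov A a p -> cov A b q -> [\/ a = b, p = b, q = a | p = q].
Proof.
move=> aA bA pA qA /unsepP h ap bq.
have [->|pb] := eqVneq p b; first by constructor 2.
have [->|qa] := eqVneq q a; first by constructor 3.
have bp : inside b p.
  by rewrite -h ?(cov_inside ap) // eq_sym (inside_neq (cov_inside ap)).
have aq : inside a q.
  by rewrite h ?(cov_inside bq) // eq_sym (inside_neq (cov_inside bq)).
case: (laminar_chain lA aA pA qA (cov_inside ap) aq) => [->|pq|qp].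
- by constructor 4.
- by move/covP: bq => [_ /(_ p pA bp pq)].
- by move/covP: ap => [_ /(_ q qA aq qp)].
Qed.

Lemma unsep_meet a b : a \in A :\ t -> b \in A :\ t -> unsep A a b ->
  meet_edges (edge_of l r phi A a) (edge_of l r phi A b).
Proof.
rewrite !inE => /andP[at' aA] /andP[bt bA] ab; apply/set0Pn.
have [u [v [ua av _]]] := models_parent mG aA at'.
have [u' [v' [ub bv _]]] := models_parent mG bA bt.
case: (unsep_parent aA bA (mod_in mG v) (mod_in mG v') ab av bv) => e.
- by exists u; rewrite !inE ua e eqxx.
- by exists v; rewrite !inE av orbT e eqxx.
- by exists v'; rewrite !inE bv orbT e eqxx.
- by exists v; rewrite !inE av e bv !orbT.
Qed.

Lemma models_walk (s : seq E) : 0 < size s -> uniq s -> s =i A :\ t ->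
  sorted (unsep A) s -> is_caterpillar G /\ num_edges G = size s.
Proof.
move=> s0 us sA ss; split; last first.
  rewrite (models_num_edges mG) -(card_uniqP us) (eq_card sA) (cardsD1 t A).
  by rewrite (mod_topA mG).
apply: (@walk_caterpillar _ (models_tree mG) (map (edge_of l r phi A) s)).
- by rewrite size_map.
- rewrite map_inj_in_uniq // => a b; rewrite !sA; exact: (edge_of_inj mG).
- move=> e; rewrite (edges_models mG); apply/mapP/imsetP => -[a].
    by rewrite sA; exists a.
  by exists a; rewrite ?sA.
- rewrite sorted_map; apply: (sub_in_sorted (P := [in A :\ t]) _ _ ss).
    by move=> a b; apply: unsep_meet.
  by apply/allP => a; rewrite sA.
Qed.

(** Deleting the edge [y] isolates its leaf end [v], so all other edges are on the side of [w]. The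
    disjunction covers a leaf that is the child and a leaf that is the parent, as the root may
    be. *)
Lemma leaf_side y v w c c' : adj v w -> leaf v ->
  (phi v = y /\ cov A y (phi w)) \/ (phi w = y /\ cov A y (phi v)) ->
  c \in A :\ t -> c' \in A :\ t -> c != y -> c' != y -> side y c = side y c'.
Proof.
move=> vw lv yvw.
have yA : y \in A by case: yvw => -[<- _]; apply: (mod_in mG).
have lf u : adj v u -> u = w.
  by move=> vu; apply/eqP; apply: contraLR lv => uw; apply: two_nbrs_nonleaf vu vw uw.
have vwy : side y (phi v) != side y (phi w).
  by case: yvw => -[e h]; rewrite -e in h *; rewrite sidexx (side_cov h).
have yname u u' : phi u = y -> cov A y (phi u') ->
    (u = v /\ u' = w) \/ (u = w /\ u' = v).
  move=> uy yu'; case: yvw => -[e h]; rewrite -e in h yu' uy;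
    have eu := mod_inj mG uy; rewrite -?eu in h yu' *.
    by left; split=> //; apply: (models_cov mG yu' h).
  by right; split=> //; apply: (models_cov mG yu' h).
(* [Q] is closed under adjacency and misses [w], so connectivity makes it empty: [v] is alone on its
   side. *)
pose Q := [pred u | (u != v) && (side y (phi u) == side y (phi v))].
have Qw : w \notin Q by rewrite inE (eq_sym (side _ _)) (negbTE vwy) andbF.
have clQ : closed (@adj G) Q.
  apply: (intro_closed (sym_connect_sym (@adj_sym G))) => u u' uu'.
  rewrite !inE => /andP[uv /eqP suv].
  have [e|ne] := eqVneq (phi u) y.
    case: (models_edge_cov uu') => h.
      rewrite e in h; case: (yname _ _ e h) => -[e1 _].
        by rewrite e1 eqxx in uv.
      by move: Qw; rewrite inE -e1 uv suv eqxx.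
    have s' : side y (phi u') = side y (phi u).
      apply: (cov_side lA yA (mod_in mG u') (mod_in mG u) h).
      by rewrite -e; apply: (inside_neq (cov_inside h)).
    rewrite s' suv eqxx andbT; apply: contraNneq Qw => e'.
    by rewrite inE -(lf u) ?uv ?suv ?eqxx // -e' adj_sym.
  have [e'|ne'] := eqVneq (phi u') y.
    case: (models_edge_cov uu') => h; last first.
      rewrite e' in h; case: (yname _ _ e' h) => -[_ e1].
        by move: Qw; rewrite inE -e1 uv suv eqxx.
      by rewrite e1 eqxx in uv.
    have s' := cov_side lA yA (mod_in mG u) (mod_in mG u') h ne.
    rewrite -s' suv eqxx andbT; apply: contraNneq Qw => e1.
    by rewrite inE -(lf u) ?uv ?suv ?eqxx // -e1 adj_sym.
  rewrite -(models_adj_side mG yA uu' ne ne') suv eqxx andbT.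
  apply: contraNneq Qw => e1.
  by rewrite inE -(lf u) ?uv ?suv ?eqxx // -e1 adj_sym.
have Q0 u : u != v -> side y (phi u) = ~~ side y (phi v).
  move=> uv; have [_ conn _] := models_tree mG.
  have /idPn : u \notin Q by rewrite (closed_connect clQ (conn u w)).
  by rewrite inE uv /=; case: (side y (phi u)); case: (side y (phi v)).
(* One end of [d] differs from [v], and both ends of [d] are on the same side of [y]. *)
have all d : d \in A :\ t -> d != y -> side y d = ~~ side y (phi v).
  rewrite !inE => /andP[dt dA] dy.
  have [u [u' [ud du' uu']]] := models_parent mG dA dt.
  have [uv|uv] := eqVneq u v; last by rewrite -ud Q0.
  rewrite -ud in du' dy *.
  rewrite (cov_side lA yA (mod_in mG u) (mod_in mG u') du' dy) Q0 //.
  by apply: contraTneq uu' => ->; rewrite uv adj_irr.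
by move=> cA c'A cy c'y; rewrite (all c) ?(all c').
Qed.

(* The edge c is pendant and, seen from c, the edges having another edge beyond
   them form a chain. *)
Definition terminal A' c := (forall z z', z \in A' -> z' \in A' ->
    z != c -> z' != c -> side c z = side c z') /\
  (forall y1 y2 z1 z2, y1 \in A' -> y2 \in A' -> z1 \in A' -> z2 \in A' ->
    y1 != c -> y2 != c -> z1 != y1 -> z2 != y2 ->
    side y1 z1 != side y1 c -> side y2 z2 != side y2 c ->
    [\/ y1 = y2, side y1 y2 != side y1 c | side y2 y1 != side y2 c]).

(** With a nonempty spine, [c] is a pendant edge at the first spine vertex. An edge with another one
    beyond it has no leaf end, so it joins consecutive spine vertices, and its position on the spine
    orders it among such edges. *)
Lemma caterpillar_terminal : is_caterpillar G -> (0 < #|A :\ t|)%N ->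
  exists2 c, c \in A :\ t & terminal (A :\ t) c.
Proof.
move=> [treeG [s [us sN sadj]]] /card_gt0P[a0 a0A].
have lfside y u v c z : cov A (phi u) (phi v) -> phi u = y ->
    c \in A :\ t -> z \in A :\ t -> c != y -> z != y ->
    side y z != side y c -> ~~ leaf u /\ ~~ leaf v.
  move=> uv uy cA zA cy zy h.
  have uv' : adj u v by rewrite (mod_adj mG) uv.
  split; apply: contra h => lf; apply/eqP.
    by apply: (leaf_side uv' lf) => //; left; rewrite -uy.
  by rewrite adj_sym in uv'; apply: (leaf_side uv' lf) => //; right; rewrite -uy.
have ends a : a \in A :\ t -> exists u v, [/\ phi u = a, cov A a (phi v) & adj u v].
  by rewrite !inE => /andP[at' aA]; apply: (models_parent mG aA at').
case: s us sN sadj => [|v1 s] us sN sadj.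
  (* With an empty spine all vertices are leaves, and an edge with a leaf end separates no two
     others: any edge will do. *)
  have lf (v : G) : leaf v.
    apply/negPn/negP => lv.
    have vN : v \in [set x : G | ~~ leaf x]%SET by rewrite inE.
    by have := sN (Sub v vN : induced [set x : G | ~~ leaf x]%SET).
  exists a0 => //; split=> [z z' zA z'A za z'a|].
    apply/eqP/negPn/negP => h; have [u [v [ua av _]]] := ends _ a0A.
    rewrite -{1}ua in av.
    by have [] := lfside _ _ _ _ _ av ua z'A zA z'a za h; rewrite lf.
  move=> y1 y2 z1 z2 y1A y2A z1A z2A y1a y2a z1y1 z2y2 h _.
  have [u [v [uy yv _]]] := ends _ y1A; rewrite -{1}uy in yv.
  have := lfside _ _ _ _ _ yv uy a0A z1A; rewrite eq_sym lf.
  by move=> /(_ y1a z1y1 h) [].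
pose s0 := map val (v1 :: s).
have us0 : uniq s0 by rewrite map_inj_uniq //; exact: val_inj.
have s0N (x : G) : ~~ leaf x -> x \in s0.
  move=> lx; have xN : x \in [set x : G | ~~ leaf x]%SET by rewrite inE.
  by rewrite -[x]/(val (Sub x xN : induced [set x : G | ~~ leaf x]%SET)) map_f.
have s0l (x : G) : x \in s0 -> ~~ leaf x.
  by move=> /mapP[y _ ->]; have := valP y; rewrite inE.
have s0adj (x y : G) : x \in s0 -> y \in s0 -> adj x y =
    ((index x s0).+1 == index y s0) || ((index y s0).+1 == index x s0).
  move=> /mapP[x' _ ->] /mapP[y' _ ->]; rewrite /s0 !(index_map val_inj) -sadj //.
have [u0 [u0' [_ _ u0u]]] := ends _ a0A.
have v1s : val v1 \in s0 by rewrite map_f ?mem_head.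
have i1 : index (val v1) s0 = 0 by rewrite /s0 /= eqxx.
(* The first spine vertex has at most one neighbour on the spine, the one at index 1, but at least
   two neighbours. *)
have [w vw lw] : exists2 w, adj (val v1) w & leaf w.
  have [a [b [va vb ab]]] := nonleaf_nbrs treeG u0u (s0l _ v1s).
  have [la|la] := boolP (leaf a); first by exists a.
  have [lb|lb] := boolP (leaf b); first by exists b.
  have as0 := s0N _ la; have bs0 := s0N _ lb; case/eqP: ab.
  rewrite -(nth_index a as0) -(nth_index a bs0); congr nth.
  by move: va vb; rewrite !s0adj // i1 => /orP[]/eqP // <- /orP[]/eqP.
have [c [cA cvw]] : exists c, c \in A :\ t /\
    ((phi w = c /\ cov A c (phi (val v1))) \/ (phi (val v1) = c /\ cov A c (phi w))).
  case: (models_edge_cov vw) => h.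
    exists (phi (val v1)); split; last by right.
    rewrite !inE (mod_in mG) andbT; apply: contraTneq h => ->.
    by rewrite (models_top_cov mG).
  exists (phi w); split; last by left.
  rewrite !inE (mod_in mG) andbT; apply: contraTneq h => ->.
  by rewrite (models_top_cov mG).
have wv : adj w (val v1) by rewrite adj_sym.
exists c => //; split=> [z z' zA z'A zc z'c|].
  exact: (leaf_side wv lw cvw).
have cside y : y \in A -> y != c -> side y c = side y (phi (val v1)).
  move=> yA yc; case: cvw => -[e h]; last by rewrite e.
  have := cov_side lA yA _ (mod_in mG (val v1)) h; rewrite -e (mod_in mG).
  by apply=> //; rewrite e eq_sym.
(* The edge [y] occupies a position [i] of the spine. The last clause lets any other edge locate [y]
   through the vertex at that position. *)
have spine y z : y \in A :\ t -> z \in A :\ t -> y != c -> z != y ->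
    side y z != side y c -> exists i, [/\ i.+1 < size s0,
      (forall j, j.+1 < size s0 -> (side y (phi (nth w s0 j)) !=
         side y (phi (nth w s0 j.+1))) = (j == i)),
      (phi (nth w s0 i) = y /\ cov A y (phi (nth w s0 i.+1))) \/
      (phi (nth w s0 i.+1) = y /\ cov A y (phi (nth w s0 i))) &
      (forall y', y' \in A -> y' != y ->
         side y' y = side y' (phi (nth w s0 i)))].
  move=> yA zA yc zy h; have [u [v [uy yv uv]]] := ends _ yA.
  have yA' : y \in A by move: yA; rewrite inE => /andP[].
  rewrite -uy in yv.
  have [|lu lv] := lfside y _ _ c z yv uy cA zA _ zy h; first by rewrite eq_sym.
  have us1 := s0N _ lu; have vs1 := s0N _ lv.
  have suv : side y (phi u) != side y (phi v).
    by rewrite -uy sidexx (side_cov yv).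
  have cross j : j.+1 < size s0 ->
      side y (phi (nth w s0 j)) != side y (phi (nth w s0 j.+1)) ->
      (nth w s0 j = u /\ nth w s0 j.+1 = v) \/ (nth w s0 j = v /\ nth w s0 j.+1 = u).
    move=> js; have js' := ltnW js.
    have ad : adj (nth w s0 j) (nth w s0 j.+1).
      by rewrite s0adj ?mem_nth // !index_uniq // eqxx.
    case: (models_edge_cov ad) => h'.
      have [e _|ne] := eqVneq (phi (nth w s0 j)) y.
        left; move: e; rewrite -uy => /(mod_inj mG) e; split=> //.
        by rewrite e in h'; apply: (models_cov mG h' yv).
      by rewrite (cov_side lA yA' (mod_in mG _) (mod_in mG _) h' ne) eqxx.
    have [e _|ne] := eqVneq (phi (nth w s0 j.+1)) y.
      right; move: e; rewrite -uy => /(mod_inj mG) e; split=> //.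
      by rewrite e in h'; apply: (models_cov mG h' yv).
    by rewrite -(cov_side lA yA' (mod_in mG _) (mod_in mG _) h' ne) eqxx.
  have [i [is1 iuv]] : exists i, i.+1 < size s0 /\
     ((nth w s0 i = u /\ nth w s0 i.+1 = v) \/ (nth w s0 i = v /\ nth w s0 i.+1 = u)).
    move: uv; rewrite s0adj // => /orP[]/eqP e.
      exists (index u s0); rewrite e index_mem; split=> //.
      by left; rewrite !nth_index.
    exists (index v s0); rewrite e index_mem; split=> //.
    by right; rewrite !nth_index.
  have is0 := ltnW is1.
  exists i; split=> //.
  - move=> j js; have js' := ltnW js.
    apply/idP/eqP => [/(cross j js)|->]; last first.
      by case: iuv => -[-> ->] //; rewrite eq_sym.
    case=> -[e1 e2]; case: iuv => -[e3 e4].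
    + by apply/eqP; rewrite -(nth_uniq w js' is0 us0) e1 e3.
    + have : j = i.+1 by apply/eqP; rewrite -(nth_uniq w js' is1 us0) e1 e4.
      have <- : j.+1 = i by apply/eqP; rewrite -(nth_uniq w js is0 us0) e2 e3.
      by move=> /eqP; rewrite (ltn_eqF (leqnSn j.+1)).
    + have : j = i.+1 by apply/eqP; rewrite -(nth_uniq w js' is1 us0) e1 e4.
      have <- : j.+1 = i by apply/eqP; rewrite -(nth_uniq w js is0 us0) e2 e3.
      by move=> /eqP; rewrite (ltn_eqF (leqnSn j.+1)).
    + by apply/eqP; rewrite -(nth_uniq w js' is0 us0) e1 e3.
  - by case: iuv => -[e1 e2]; [left|right]; rewrite e1 e2 -uy.
  - move=> y' y'A y'y; case: iuv => -[-> _]; first by rewrite uy.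
    rewrite -uy; apply: (cov_side lA y'A (mod_in mG u) (mod_in mG v) yv).
    by rewrite uy eq_sym.
move=> y1 y2 z1 z2 y1A y2A z1A z2A y1c y2c z1y1 z2y2 h1 h2.
have [i [is1 iP i3 i4]] := spine _ _ y1A z1A y1c z1y1 h1.
have [j [js1 jP j3 j4]] := spine _ _ y2A z2A y2c z2y2 h2.
have [->|y12] := eqVneq y1 y2; first by constructor 1.
have [y1A' y2A'] : y1 \in A /\ y2 \in A.
  by move: y1A y2A; rewrite !inE => /andP[_ ->] /andP[_ ->].
have v10 : val v1 = nth w s0 0 by [].
(* As [c] hangs at position 0, a spine edge at position [n] lies beyond one at position [k < n]. *)
have key y y' k n : y \in A -> y' \in A -> y' != c -> y != y' -> k.+1 < size s0 ->
    n.+1 < size s0 -> k < n ->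
    (forall j, j.+1 < size s0 ->
    (side y' (phi (nth w s0 j)) != side y' (phi (nth w s0 j.+1))) = (j == k)) ->
    side y' y = side y' (phi (nth w s0 n)) -> side y' y != side y' c.
  move=> yA y'A y'c yy' ks ns kn kP ->.
  rewrite cside // v10 eq_sym (single_flip kP (leq0n k) (ltnW ks)) ?leqnn //.
  by rewrite -(single_flip kP kn (ltnW ns)) ?ltnSn ?orbT // kP ?eqxx.
have [ij|ji|ij] := ltngtP i j.
- by constructor 2; apply: (key _ _ i j) => //; [rewrite eq_sym|apply: j4].
- by constructor 3; apply: (key _ _ j i) => //; apply: i4 => //; rewrite eq_sym.
- exfalso; subst j; case: i3 j3 => -[e1 e2] [] [e3 e4].
  + by move: y12; rewrite -e1 -e3 eqxx.
  + by rewrite e1 in e4; rewrite e3 in e2; move/cov_inside/inside_asym: e2; rewrite (cov_inside e4).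
  + by rewrite e1 in e4; rewrite e3 in e2; move/cov_inside/inside_asym: e2; rewrite (cov_inside e4).
  + by move: y12; rewrite -e1 -e3 eqxx.
Qed.

End Graph.
End Separation.

(** * Realising a walk of edges by contraction or by removal of vertices *)

Section Operations.
Variables (E : finType) (l r : E -> nat).
Implicit Types (a b c d p t : E) (A B : {set E}).
Local Notation inside := (inside l r).
Local Notation side := (side l r).
Local Notation cov := (cov l r).
Local Notation unsep := (unsep l r).

Lemma contraction_of_walk (G : graph) (phi : G -> E) A t (s : seq E) :
  models l r phi A t -> 0 < size s -> uniq s -> {subset s <= A :\ t} ->
  sorted (unsep [set x in s]) s ->
  exists H, [/\ contracts_to G H, is_caterpillar H & num_edges H = size s].
Proof.
move=> mG s0 us sA ss; pose B := t |: [set x in s]%SET.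
have st : t \notin s by apply/negP => /sA; rewrite !inE eqxx.
have [|H [psi [GH mH]]] := contracts_to_models mG (B := B) _ (setU11 _ _).
  apply/fintype.subsetP => x; rewrite !inE => /orP[/eqP->|/sA].
    exact: (mod_topA mG).
  by rewrite inE => /andP[].
exists H; have [||cH nH] := models_walk mH s0 us; last by split.
  by move=> x; rewrite !inE; have [->|//] := eqVneq x t; apply/negbTE.
apply: (sub_in_sorted (P := [in s]) _ _ ss); last exact/allP.
(* The outermost [t] encloses all of [s], so adding it creates no separation. *)
move=> a b asx bsx /unsepP h; apply/unsepP => d; rewrite !inE => /orP[/eqP->|ds].
  have top x : x \in s -> inside x t.
    by move=> /sA; rewrite !inE => /andP[xt xA]; apply: (mod_top mG).
  by rewrite !top.
by apply: h; rewrite inE.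
Qed.

End Operations.

Section Subtree.
Variables (G : graph) (l r : G -> nat) (t0 : G).
Hypothesis mG : models l r (@id G) [set: G]%SET t0.
Implicit Types (x y z d : G) (U : {set G}).
Let lG := mod_lam mG.

Let step x y d : adj x y -> side l r d x != side l r d y ->
  (x = d /\ cov l r [set: G]%SET d y) \/ (y = d /\ cov l r [set: G]%SET d x).
Proof.
rewrite (mod_adj mG) => /orP[] h s; [left|right].
  have [xd|ne] := eqVneq x d; first by split=> //; rewrite -xd.
  by rewrite (cov_side lG _ _ _ h ne) ?inE ?eqxx in s.
have [yd|ne] := eqVneq y d; first by split=> //; rewrite -yd.
by rewrite (cov_side lG _ _ _ h ne) ?inE ?eqxx in s.
Qed.

(** A path inside [U] from one side of [d] to the other has to use the edge [d], whose ends are [d]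
    and its parent. *)
Let subtree_step U d x y : is_tree (induced U) -> x \in U -> y \in U ->
  side l r d x != side l r d y ->
  exists2 z, d \in U & z \in U /\ cov l r [set: G]%SET d z.
Proof.
move=> [_ conn _] xU yU.
have /connectP[s] := conn (Sub x xU) (Sub y yU).
have -> : side l r d x = side l r d (val (Sub x xU : induced U)) by [].
have -> : side l r d y = side l r d (val (Sub y yU : induced U)) by [].
move: (Sub x xU : induced U) (Sub y yU : induced U) => {xU yU}x {}y.
elim: s x => [|z s IH] x /= => [_ ->|/andP[xz zs] ey sxy]; first by rewrite eqxx.
have [e|ne] := eqVneq (side l r d (val x)) (side l r d (val z)).
  by apply: (IH _ zs ey); rewrite -e.
case: (step xz ne) => -[<- h]; [exists (val z)|exists (val x)];
  by try split; try exact: valP.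
Qed.

(** The widest bracket of [U] is its root. Any other one is joined to it inside [U], which forces
    its parent in [G] to belong to [U]; thus the parents within [U] are those of [G]. *)
Lemma induced_models U : is_tree (induced U) ->
  (exists t, models l r (val : induced U -> G) U t) /\
  (forall d, d \notin U -> forall x y, x \in U -> y \in U ->
     side l r d x = side l r d y).
Proof.
move=> treeU; split; last first.
  move=> d dU x y xU yU; apply/eqP/negPn/negP => h.
  by have [z dU'] := subtree_step treeU xU yU h; rewrite dU' in dU.
have [/card_gt0P[u0 _] _ _] := treeU.
case: (@arg_maxnP _ (val u0) [in U] (fun x => r x - l x)) => [|t tU tmax].
  exact: valP.
have lt' x : x \in U -> inside l r t x = false.
  move=> xU; apply/negP => tx; have := tmax x xU.
  by have := lG.1 t; have := lG.1 x; rewrite !inE; move: tx; rewrite /inside; lia.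
have top x : x \in U -> x != t -> inside l r x t.
  move=> xU xt; have : side l r t x.
    apply/negPn/negP => h.
    have [|z _ [zU /cov_inside]] := @subtree_step U t t x treeU tU xU.
      by rewrite sidexx (negbTE h).
    by rewrite lt'.
  by rewrite /side (negbTE xt).
have par x : x \in U -> x != t -> exists2 p, p \in U & cov l r [set: G]%SET x p.
  move=> xU xt; have [|z _ [zU h]] := @subtree_step U x x t treeU xU tU.
    rewrite sidexx /side [t == x]eq_sym (negbTE xt) /= lt' //.
  by exists z.
have covE x y : x \in U -> y \in U -> cov l r U x y = cov l r [set: G]%SET x y.
  move=> xU yU; apply/idP/idP => [/covP[xy h]|/covP[xy h]]; last first.
    by apply/covP; split=> // z _; apply: h.
  have xt : x != t by apply: contraTneq xy => ->; rewrite lt'.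
  have [p pU xp] := par x xU xt.
  have inG z : z \in [set: G]%SET by rewrite inE.
  case: (laminar_chain lG (inG x) (inG y) (inG p) xy (cov_inside xp)) => [->//|yp|py].
    by move/covP: xp => [_ /(_ y)]; rewrite inE => /(_ isT xy yp).
  by case: (h p pU (cov_inside xp) py).
exists t; split=> //.
- by apply: laminarS lG; apply: finset.subsetT.
- exact: val_inj.
- by move=> u; apply: valP.
- by move=> a aU; exists (Sub a aU).
- move=> u v; rewrite -[adj u v]/(adj (val u) (val v)) (mod_adj mG).
  by rewrite !covE //; apply: valP.
Qed.

(** The ends of the edges in [s] are kept. They induce a connected graph because successive edges
    meet; the delicate point is that no edge outside [s] has both ends among them. *)
Lemma removal_of_walk (s : seq G) : 0 < size s -> uniq s -> t0 \notin s ->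
  sorted (unsep l r [set: G]%SET) s ->
  exists X : {set G}, is_caterpillar (remove_vertices X) /\
    num_edges (remove_vertices X) = size s.
Proof.
move=> s0 us ts ss.
pose U := [set x | [exists a in s, (x == a) || cov l r [set: G]%SET a x]]%SET.
exists (~: U)%SET; rewrite /remove_vertices finset.setCK.
have [_ _ acyc] := models_tree mG.
have UP x : reflect (exists2 a, a \in s & (x = a) \/ cov l r [set: G]%SET a x) (x \in U).
  rewrite inE; apply: (iffP exists_inP) => -[a aS h]; exists a => //.
    by case/orP: h => [/eqP|]; [left|right].
  by case: h => [->|->]; rewrite ?eqxx ?orbT.
have sU a : a \in s -> a \in U by move=> aS; apply/UP; exists a => //; left.
have par a : a \in s -> exists2 p, p \in U & cov l r [set: G]%SET a p.
  move=> aS; have at0 : a != t0 by apply: contraNneq ts => <-.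
  have [u [v [_ av _]]] := models_parent mG (finset.in_setT a) at0.
  by exists v => //; apply/UP; exists a => //; right.
have treeU : is_tree (induced U).
  split.
  - case: (s) s0 sU => // a s' _ /(_ a (mem_head _ _)) aU.
    by apply/card_gt0P; exists (Sub a aU).
  - have conn1 (x y : induced U) : adj (val x) (val y) -> connect (@adj (induced U)) x y.
      by move=> xy; apply: connect1.
    pose mk a (aS : a \in s) : induced U := Sub a (sU a aS).
    have mkE a (aS : a \in s) : val (mk a aS) = a by [].
    have symU := sym_connect_sym (@adj_sym (induced U)).
    have same (x y : induced U) a : a \in s ->
        (val x = a) \/ cov l r [set: G]%SET a (val x) ->
        (val y = a) \/ cov l r [set: G]%SET a (val y) -> connect (@adj (induced U)) x y.
      move=> aS; have covadj p : cov l r [set: G]%SET a p -> adj a p.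
        by rewrite (mod_adj mG) => ->.
      case=> [xa|ax] [ya|ay].
      + by rewrite (_ : x = y) ?connect0 //; apply: val_inj; rewrite xa.
      + by apply: conn1; rewrite xa; apply: covadj.
      + by rewrite symU; apply: conn1; rewrite ya; apply: covadj.
      + rewrite (_ : x = y) ?connect0 //; apply: val_inj.
        exact: (cov_uniq lG (finset.in_setT a) (finset.in_setT _) (finset.in_setT _) ax ay).
    have walk a s' (x y : induced U) : {subset a :: s' <= s} ->
        path (unsep l r [set: G]%SET) a s' ->
        val x = a -> val y \in a :: s' -> connect (@adj (induced U)) x y.
      elim: s' a x => [|b s' IH] a x sub /=.
        move=> _ xa; rewrite inE => /eqP ya.
        by apply: (same _ _ a); [apply: sub; rewrite mem_head|left|left].
      move=> /andP[ab bs] xa; rewrite inE => /orP[/eqP ya|yb].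
        by apply: (same _ _ a); [apply: sub; rewrite mem_head|left|left].
      have aS : a \in s by apply: sub; rewrite mem_head.
      have bS : b \in s by apply: sub; rewrite !inE eqxx orbT.
      have sub' : {subset b :: s' <= s}.
        by move=> z zs; apply: sub; rewrite inE zs orbT.
      apply: connect_trans (IH b (mk b bS) sub' bs erefl yb).
      have [p pU ap] := par a aS; have [q qU bq] := par b bS.
      have := unsep_parent mG (finset.in_setT a) (finset.in_setT b)
        (finset.in_setT p) (finset.in_setT q) ab ap bq.
      case=> e.
      + exact: (same _ _ b bS (or_introl (etrans xa e)) (or_introl (mkE b bS))).
      + by apply: (same _ _ a aS (or_introl xa)); right; rewrite /= -e.
      + by apply: (same _ _ b bS _ (or_introl (mkE b bS))); right; move: bq; rewrite e -xa.
      + pose mp : induced U := Sub p pU.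
        have mpE : val mp = p by [].
        apply: (connect_trans (y := mp)).
          by apply: (same _ _ a aS (or_introl xa)); right; rewrite mpE.
        by apply: (same _ _ b bS _ (or_introl (mkE b bS))); right; rewrite mpE e.
    have [a [s' es]] : exists a s', s = a :: s'.
      by case: (s) s0 => // a s' _; exists a, s'.
    have aS : a \in s by rewrite es mem_head.
    have base (y : induced U) : connect (@adj (induced U)) (mk a aS) y.
      have /UP[b bS h] := valP y.
      apply: (connect_trans (y := mk b bS)).
        apply: (walk a s') => //; rewrite -?es //.
        by move: ss; rewrite es.
      exact: (same _ _ b bS (or_introl (mkE b bS)) h).
    by move=> x y; apply: connect_trans (base y); rewrite symU.
  - move=> c /andP[cc uc]; rewrite -(size_map val); apply: acyc.
    apply/andP; split; last by rewrite map_inj_uniq //; exact: val_inj.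
    by rewrite cycle_map.
have [[t mU] _] := induced_models treeU.
have st a : a \in s -> a != t.
  move=> aS; have [p pU /cov_inside ap] := par a aS.
  apply: contraTneq ap => ->; apply/negP => tp.
  have [e|/(mod_top mU pU)] := eqVneq p t; first by rewrite e insidexx in tp.
  by move=> /inside_asym; rewrite tp.
(* An edge outside [s] separates no two successive members of the walk, hence no two members. *)
have sepU a : a \notin s -> forall b c, b \in s -> c \in s ->
    inside l r b a = inside l r c a.
  move=> aS.
  have hd s' h : path (unsep l r [set: G]%SET) h s' -> a \notin h :: s' ->
      forall b, b \in h :: s' -> inside l r b a = inside l r h a.
    elim: s' h => [|g s' IH] h /=; first by move=> _ _ b; rewrite inE => /eqP->.
    move=> /andP[/unsepP hg gs]; rewrite inE negb_or => /andP[ah ag] b.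
    rewrite inE => /orP[/eqP->//|bs]; rewrite (IH g) // hg ?inE //.
    by move: ag; rewrite inE negb_or => /andP[].
  case: (s) aS ss => // h s' aS ss b c bS cS.
  by rewrite (hd s' h ss aS b bS) (hd s' h ss aS c cS).
apply: (models_walk mU s0 us).
  move=> a; rewrite finset.in_setD1; apply/idP/andP => [aS|[at' aU]].
    by rewrite st // sU.
  have [u [v [ua av _]]] := models_parent mU aU at'.
  (* An unvisited [a] is kept only as the parent of some [b] in [s], so all of [s] lies inside [a].
     Then the parent [v] of [a] is neither in [s] nor the parent of a member of [s], though it is
     kept. *)
  apply/negPn/negP => aS.
  have /UP[b bS [e|ba]] := aU; first by rewrite e bS in aS.
  have /UP[c cS h] := valP v.
  have := sepU a aS b c bS cS; rewrite (cov_inside ba) => /esym ca.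
  case: h => [e|/covP[cv h]].
    by rewrite -e in ca; move: (cov_inside av); rewrite /= (inside_asym ca).
  by apply: (h a (finset.in_setT a) ca (cov_inside av)).
apply: (sub_sorted _ ss) => a b; apply: unsepS; exact: finset.subsetT.
Qed.

End Subtree.

Section BracketGraph.
Variables (E : finType) (l r : E -> nat).

Definition bracket_adj : rel E :=
  fun x y => cov l r [set: E]%SET x y || cov l r [set: E]%SET y x.

Lemma bracket_sym : symmetric bracket_adj.
Proof. by move=> x y; rewrite /bracket_adj orbC. Qed.

Lemma bracket_irr : irreflexive bracket_adj.
Proof. by move=> x; apply/negP => /orP[] /cov_inside; rewrite insidexx. Qed.

Definition bracket_graph := Graph bracket_sym bracket_irr.

Lemma bracket_models t : laminar l r [set: E]%SET ->
  (forall x, x != t -> inside l r x t) ->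
  models l r (id : bracket_graph -> E) [set: E]%SET t.
Proof. by move=> lE top; split=> // [a _|a _]; [exists a|apply: top]. Qed.

End BracketGraph.

(** * Points in convex position *)

Section Plane.
Local Open Scope classical_set_scope.
Local Open Scope ring_scope.
Variable R : realType.
Local Notation plane := 'rV[R]_2.
Implicit Types x y z a b c d : plane.

Lemma plane_eq x y : x 0 0 = y 0 0 -> x 0 1 = y 0 1 -> x = y.
Proof.
move=> e0 e1; apply/rowP => i.
have [->|->//] : i = 0 \/ i = 1; last exact: e0.
by case: i => -[|[|//]] h; [left|right]; apply: val_inj.
Qed.

(** Twice the signed area of the triangle [xyz]. *)
Definition orient x y z : R :=
  (y 0 0 - x 0 0) * (z 0 1 - x 0 1) - (y 0 1 - x 0 1) * (z 0 0 - x 0 0).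

Lemma orient_rot x y z : orient x y z = orient y z x.
Proof. by rewrite /orient; ring. Qed.

Lemma orientC x y z : orient x z y = - orient x y z.
Proof. by rewrite /orient; ring. Qed.

(** Barycentric coordinates of [x] in the triangle [abc], without division. *)
Lemma orient_hull x a b c :
  orient x b c *: a + orient x c a *: b + orient x a b *: c = orient a b c *: x.
Proof. by apply: plane_eq; rewrite !mxE /orient; ring. Qed.

Lemma orient_sum x a b c :
  orient a b c = orient x b c + orient x c a + orient x a b.
Proof. by rewrite /orient; ring. Qed.

Lemma orient_comb (t : R) x y a b :
  orient x y ((1 - t) *: a + t *: b) = (1 - t) * orient x y a + t * orient x y b.
Proof. by rewrite /orient !mxE; ring. Qed.

Lemma orient_xyx x y : orient x y x = 0. Proof. by rewrite /orient; ring. Qed.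
Lemma orient_xyy x y : orient x y y = 0. Proof. by rewrite /orient; ring. Qed.

Lemma segment_left x y : segment x y x.
Proof. by exists 0; rewrite /= ?lexx ?ler01 // subr0 scale1r scale0r addr0. Qed.

Lemma segment_right x y : segment x y y.
Proof. by exists 1; rewrite /= ?lexx ?ler01 // subrr scale1r scale0r add0r. Qed.

Lemma open_segment_sub x y : open_segment x y `<=` segment x y.
Proof. by move=> z [t /= /andP[t0 t1] <-]; exists t; rewrite //= !ltW. Qed.

Lemma segmentC x y : segment x y = segment y x.
Proof.
suff sub (u v : plane) : segment u v `<=` segment v u by apply/seteqP; split; apply: sub.
move=> z [t /= /andP[t0 t1] <-]; exists (1 - t) => /=; first by lra.
by apply: plane_eq; rewrite !mxE; ring.
Qed.

(** The affine function [orient c d] vanishes on the segment [cd] and keeps a constant sign on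
    [ab]. *)
Lemma same_side_disjoint a b c d :
  0 < orient c d a * orient c d b -> segment a b `&` segment c d = set0.
Proof.
move=> h; apply/seteqP; split=> // z [[t /= /andP[t0 t1] <-] [u _]].
move=> /(congr1 (orient c d)); rewrite !orient_comb orient_xyx orient_xyy.
rewrite !mulr0 addr0; move: h; move: (orient c d a) (orient c d b) => A B h.
have [A0|A0|A0] := ltgtP A 0; last by rewrite A0 mul0r ltxx in h.
  have B0 : B < 0 by nra.
  have [->|t'] := eqVneq t 0; first by lra.
  have : t * B < 0 by rewrite nmulr_llt0 // lt_neqAle eq_sym t'.
  by nra.
have B0 : 0 < B by nra.
have [->|t'] := eqVneq t 0; first by lra.
have : 0 < t * B by rewrite mulr_gt0 // lt_neqAle eq_sym t'.
by nra.
Qed.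

Lemma opposite_sides_cross a b c d :
  orient c d a * orient c d b < 0 -> orient a b c * orient a b d < 0 ->
  crosses a b c d.
Proof.
move=> h1 h2.
have e1 : orient c d b - orient c d a = orient a b c - orient a b d.
  by rewrite /orient; ring.
have e2 : orient c d b *: a - orient c d a *: b =
    orient a b c *: d - orient a b d *: c.
  by apply: plane_eq; rewrite !mxE /orient; ring.
move: (orient c d a) (orient c d b) (orient a b c) (orient a b d) h1 h2 e1 e2.
move=> A B C D h1 h2 e1 e2.
have n : B - A != 0 by apply/eqP => e; nra.
have aux (U V : R) : U * V < 0 -> V - U != 0 -> 0 < - U / (V - U) < 1.
  move=> UV nUV; have := divfK nUV (- U); set w := - U / _ => ew.
  have [s|s|s] := ltgtP U 0; last by rewrite s mul0r ltxx in UV.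
    have V0 : 0 < V by nra.
    by apply/andP; split; nra.
  have V0 : V < 0 by nra.
  by apply/andP; split; nra.
(* The parameter at which [orient c d] vanishes along [ab]; [e1] and [e2] identify this point with
   the one computed along [cd]. *)
exists ((1 - (- A / (B - A))) *: a + (- A / (B - A)) *: b); split.
  by exists (- A / (B - A)) => //=; apply: aux.
exists (C / (C - D)) => /=.
  rewrite -mulrNN -invrN opprB; apply: aux => //.
  by rewrite -opprB oppr_eq0 -e1.
have n' : C - D != 0 by rewrite -e1.
have -> : (1 - C / (C - D)) *: c + (C / (C - D)) *: d =
    (C - D)^-1 *: (C *: d - D *: c).
  by apply: plane_eq; rewrite !mxE; field.
rewrite -e2 -e1.
by apply: plane_eq; rewrite !mxE; field.
Qed.

Lemma consecutive_segments a b c : orient a b c != 0 ->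
  segment a b `&` segment b c = [set b].
Proof.
move=> n; apply/seteqP; split=> [z [[t _ <-] [u _]]|_ ->]; last first.
  by split; [apply: segment_right|apply: segment_left].
move=> e; have := congr1 (orient a b) e.
rewrite !orient_comb orient_xyx orient_xyy !mulr0 !addr0 add0r.
move=> /eqP; rewrite mulf_eq0 (negbTE n) orbF => /eqP u0.
by rewrite /= -e u0 subr0 scale1r scale0r addr0.
Qed.

Section Ranked.
Variables (I : finType) (P : I -> plane).
Implicit Types i j k l e : I.

(* The points P i, in increasing order of rk, are the vertices of a convex
   polygon read counterclockwise. *)
Definition ranked (rk : I -> nat) := injective rk /\
  forall i j k, (rk i < rk j)%N -> (rk j < rk k)%N -> 0 < orient (P i) (P j) (P k).

Definition between (rk : I -> nat) i j k :=
  (minn (rk i) (rk j) < rk k < maxn (rk i) (rk j))%N.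

Lemma orient_between rk i j k : ranked rk -> i != j -> k != i -> k != j ->
  if between rk i j k == (rk i < rk j)%N then orient (P i) (P j) (P k) < 0
  else 0 < orient (P i) (P j) (P k).
Proof.
move=> [inj h]; rewrite -!(inj_eq inj) /between => ij ki kj.
have [lij|lji|/eqP] := ltngtP (rk i) (rk j); last by rewrite (negbTE ij).
- have [lki|lik|/eqP] := ltngtP (rk k) (rk i); last by rewrite (negbTE ki).
    by rewrite orient_rot orient_rot; apply: h.
  have [lkj|ljk|/eqP] := ltngtP (rk k) (rk j); last by rewrite (negbTE kj).
    by rewrite /= orientC oppr_lt0; apply: h.
  by apply: h.
- have [lki|lik|/eqP] := ltngtP (rk k) (rk i); last by rewrite (negbTE ki).
    have [lkj|ljk|/eqP] := ltngtP (rk k) (rk j); last by rewrite (negbTE kj).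
      by rewrite /= orient_rot orient_rot orientC oppr_lt0; apply: h.
    by rewrite /= orient_rot; apply: h.
  rewrite [(rk j < rk k)%N](ltn_trans lji lik) /=.
  by rewrite orient_rot orientC oppr_lt0; apply: h.
Qed.

Lemma between_side rk i j k l : ranked rk -> i != j -> k != i -> k != j ->
  l != i -> l != j ->
  if between rk i j k == between rk i j l
  then 0 < orient (P i) (P j) (P k) * orient (P i) (P j) (P l)
  else orient (P i) (P j) (P k) * orient (P i) (P j) (P l) < 0.
Proof.
move=> hr ij ki kj li lj.
have := orient_between hr ij ki kj; have := orient_between hr ij li lj.
by case: between; case: between; case: (_ < _)%N => /=; nra.
Qed.

Lemma between_interleave rk i j k l : ranked rk -> k != i -> k != j ->
  l != i -> l != j -> between rk i j k != between rk i j l ->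
  between rk k l i != between rk k l j.
Proof. by move=> [inj _]; rewrite -!(inj_eq inj) /between; lia. Qed.

Lemma ranked_disjoint rk i j k l : ranked rk -> i != j -> k != i -> k != j ->
  l != i -> l != j -> between rk i j k = between rk i j l ->
  segment (P k) (P l) `&` segment (P i) (P j) = set0.
Proof.
move=> hr ij ki kj li lj e; apply: same_side_disjoint.
by have := between_side hr ij ki kj li lj; rewrite e eqxx.
Qed.

Lemma ranked_crosses rk i j k l : ranked rk -> i != j -> k != i -> k != j ->
  l != i -> l != j -> k != l -> between rk i j k != between rk i j l ->
  crosses (P k) (P l) (P i) (P j).
Proof.
move=> hr ij ki kj li lj kl e; apply: opposite_sides_cross.
  by have := between_side hr ij ki kj li lj; rewrite (negbTE e).
have := between_interleave hr ki kj li lj e.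
have := @between_side rk k l i j hr kl; rewrite ![_ == k]eq_sym ![_ == l]eq_sym.
by move=> /(_ ki li kj lj) + /negbTE ne; rewrite ne.
Qed.

Lemma ranked_consecutive rk i j k : ranked rk -> i != j -> k != i -> k != j ->
  segment (P i) (P j) `&` segment (P j) (P k) = [set P j].
Proof.
move=> hr ij ki kj; apply: consecutive_segments.
by have := orient_between hr ij ki kj; case: ifP => _ h; [rewrite lt_eqF|rewrite gt_eqF].
Qed.

(** The right-hand side mentions no ranking, which makes comparison of sides independent of the
    cut. *)
Lemma between_orient rk i j k l : ranked rk -> i != j -> k != i -> k != j ->
  l != i -> l != j -> (between rk i j k == between rk i j l) =
  (0 < orient (P i) (P j) (P k) * orient (P i) (P j) (P l)).
Proof.
move=> hr ij ki kj li lj; have := between_side hr ij ki kj li lj.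
by case: (_ == _) => h; [rewrite h|rewrite (lt_gtF h)].
Qed.

Section Convex.
Hypothesis cP : convex_position P.

(** The indices [j], [k], [l] may coincide and weights may vanish, so this also excludes equal
    points and a point between two others. *)
Lemma convex_hull3 (u v w : R) i j k l : 0 <= u -> 0 <= v -> 0 <= w ->
  0 < u + v + w -> j != i -> k != i -> l != i ->
  u *: P j + v *: P k + w *: P l = (u + v + w) *: P i -> False.
Proof.
move=> u0 v0 w0 s0 ji ki li e; set s := u + v + w in s0 e.
have sn : s != 0 by rewrite gt_eqF.
pose W m := s^-1 * (u * (m == j)%:R + v * (m == k)%:R + w * (m == l)%:R).
have sumd m (F : I -> plane) : \sum_n (n == m)%:R *: F n = F m.
  rewrite (bigD1 m) //= eqxx scale1r big1 ?addr0 // => n /negbTE ->.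
  by rewrite scale0r.
have sumr m : \sum_n (n == m)%:R = 1 :> R.
  by rewrite (bigD1 m) //= eqxx big1 ?addr0 // => n /negbTE ->.
apply: (cP (i := i) (w := W)).
- by move=> m; rewrite mulr_ge0 ?invr_ge0 ?(ltW s0) // !addr_ge0 // mulr_ge0 // ler0n.
- by rewrite /W ![i == _]eq_sym (negbTE ji) (negbTE ki) (negbTE li) !mulr0 !addr0 mulr0.
- by rewrite -mulr_sumr !big_split /= -!mulr_sumr !sumr !mulr1 mulVf.
have -> : \sum_m W m *: P m = s^-1 *: (u *: P j + v *: P k + w *: P l).
  under eq_bigr do rewrite -scalerA !scalerDl -!scalerA.
  by rewrite -scaler_sumr !big_split /= -!scaler_sumr !sumd.
by rewrite e scalerA mulVf // scale1r.
Qed.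

Lemma convex_inj i j : i != j -> P i != P j.
Proof.
move=> ij; apply/eqP => e.
apply: (@convex_hull3 1 0 0 i j j j); rewrite ?ler01 ?addr0 ?ltr01 1?eq_sym //.
by rewrite e !scale0r !addr0.
Qed.

Lemma convex_orient_neq0 i j k : i != j -> i != k -> j != k ->
  orient (P i) (P j) (P k) != 0.
Proof.
move=> ij ik jk; apply/eqP => o.
(* The scalar product of [b - a] and [c - a]. For collinear points, [c] is a combination of [a] and
   [b] with weights [D b a c] and [D a b c], whose sum is the squared distance from [a] to [b]. A
   case split on signs finds a point whose two weights are nonnegative. *)
pose D a b c := (b 0 0 - a 0 0) * (c 0 0 - a 0 0) +
  (b 0 1 - a 0 1) * (c 0 1 - a 0 1) : R.
have hullD a b c : orient a b c = 0 ->
    D b a c *: a + D a b c *: b + 0 *: a = (D b a c + D a b c + 0) *: c.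
  move=> o'; apply: plane_eq; rewrite !mxE /D.
    transitivity ((D b a c + D a b c + 0) * c 0 0 + orient a b c * (b 0 1 - a 0 1)).
      by rewrite /D /orient; ring.
    by rewrite o' mul0r addr0.
  transitivity ((D b a c + D a b c + 0) * c 0 1 - orient a b c * (b 0 0 - a 0 0)).
    by rewrite /D /orient; ring.
  by rewrite o' mul0r subr0.
have pos a b c : a != b -> 0 < D b a c + D a b c.
  move=> ab; have -> : D b a c + D a b c =
      (b 0 0 - a 0 0) ^+ 2 + (b 0 1 - a 0 1) ^+ 2 by rewrite /D; ring.
  rewrite lt_neqAle eq_sym addr_ge0 ?sqr_ge0 // andbT paddr_eq0 ?sqr_ge0 //.
  rewrite !sqrf_eq0 !subr_eq0; apply: contra ab => /andP[/eqP e0 /eqP e1].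
  by apply/eqP/plane_eq.
have DC a b c : D a b c = D a c b by rewrite /D; ring.
have Pij := convex_inj ij; have Pik := convex_inj ik; have Pjk := convex_inj jk.
have hull (l m n : I) : l != n -> m != n -> l != m ->
    orient (P l) (P m) (P n) = 0 -> 0 <= D (P m) (P l) (P n) ->
    0 <= D (P l) (P m) (P n) -> False.
  move=> ln mn lm o' h1 h2.
  apply: (convex_hull3 h1 h2 (lexx 0) _ ln mn ln (hullD _ _ _ o')).
  by rewrite addr0; apply: pos; apply: convex_inj.
have := pos _ _ (P k) Pij; have := pos _ _ (P j) Pik; have := pos _ _ (P i) Pjk.
rewrite (DC (P k) (P j) (P i)) (DC (P j) (P k)) (DC (P i) (P k)).
move=> p1 p2 p3.
have [h1|h1] := leP 0 (D (P i) (P j) (P k)); last first.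
  apply: (hull j k i) => //; rewrite 1?eq_sym //.
  - by rewrite -orient_rot.
  - by rewrite DC; lra.
  - by rewrite DC; lra.
have [h2|h2] := leP 0 (D (P j) (P i) (P k)); first exact: (hull i j k).
apply: (hull k i j) => //; rewrite 1?eq_sym //.
- by rewrite orient_rot.
- by rewrite DC; lra.
- by lra.
Qed.

(** Otherwise the point at [e] would lie in the triangle of the other three. *)
Lemma convex_trans e i j k : i != e -> j != e -> k != e ->
  0 < orient (P e) (P i) (P j) -> 0 < orient (P e) (P j) (P k) ->
  i != k -> 0 < orient (P e) (P i) (P k).
Proof.
move=> ie je ke h1 h2 ik; rewrite ltNge; apply/negP => h3.
apply: (@convex_hull3 (orient (P e) (P j) (P k)) (orient (P e) (P k) (P i))
  (orient (P e) (P i) (P j)) e i j k) => //.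
- exact: ltW.
- by rewrite orientC oppr_ge0.
- exact: ltW.
- by rewrite (orientC (P e) (P i) (P k)); lra.
- by rewrite orient_hull (orient_sum (P e)).
Qed.

(** The points are sorted by angle around [e], which comes first, and ranked by their number of
    predecessors. The choice of [e] is the freedom to cut the circle anywhere. *)
Lemma convex_ranked e : exists2 rk, ranked rk & rk e = 0%N.
Proof.
pose bef i j := (j != e) && ((i == e) || (0 < orient (P e) (P i) (P j))).
have befT i j k : bef i j -> bef j k -> bef i k.
  move=> /andP[je h] /andP[ke /orP[/eqP ee|h']]; first by rewrite ee eqxx in je.
  rewrite /bef ke; case: eqVneq h => //= ie h.
  apply: (@convex_trans e i j k) => //.
  apply: contraTneq h' => <-; rewrite orientC oppr_gt0 -leNgt; exact: ltW.
have befxx i : bef i i = false.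
  by rewrite /bef orient_xyy ltxx orbF andNb.
have tot i j : i != j -> bef i j || bef j i.
  move=> ij; rewrite /bef; have [e'|ie] := eqVneq i e.
    by move: ij; rewrite e' eq_sym => ->.
  have [->|je] := eqVneq j e; first by rewrite orbT.
  have := convex_orient_neq0 (i := e) (j := i) (k := j).
  rewrite ![e == _]eq_sym => /(_ ie je ij); rewrite neq_lt /= => /orP[h|->//].
  by rewrite (orientC (P e) (P i) (P j)) oppr_gt0 h orbT.
pose rk j := #|[set i | bef i j]%SET|.
have mono i j : bef i j -> (rk i < rk j)%N.
  move=> ij; apply: proper_card; apply/fintype.properP; split.
    by apply/fintype.subsetP => k; rewrite !inE => /befT; apply.
  by exists i; rewrite !inE ?befxx.
have lt i j : (rk i < rk j)%N -> bef i j.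
  move=> ij; have [e'|ne] := eqVneq i j; first by rewrite e' ltnn in ij.
  by case/orP: (tot i j ne) => // /mono; rewrite ltnNge ltnW.
exists rk; last first.
  by apply/eqP; rewrite cards_eq0; apply/eqP/setP => i; rewrite !inE /bef eqxx.
split.
  move=> i j e'; apply/eqP/negPn/negP => ij.
  by case/orP: (tot i j ij) => /mono; rewrite e' ltnn.
move=> i j k /lt ij /lt jk; have ik := befT _ _ _ ij jk.
have [je h1] := andP ij; have [ke h2] := andP jk; have [_ h3] := andP ik.
rewrite (negbTE je) /= in h2.
have [ee|ie] := eqVneq i e; first by rewrite ee.
rewrite (negbTE ie) /= in h1 h3.
(* Otherwise the point at [j] would lie in the triangle of [e], [i], [k]. *)
rewrite ltNge; apply/negP => h.
apply: (@convex_hull3 (orient (P j) (P i) (P k)) (orient (P j) (P k) (P e))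
  (orient (P j) (P e) (P i)) j e i k).
- by rewrite orient_rot orientC oppr_ge0.
- by rewrite -orient_rot ltW.
- by rewrite orient_rot ltW.
- rewrite -orient_sum; exact: h3.
- by rewrite eq_sym.
- by apply: contraTneq ij => ->; rewrite befxx.
- by apply: contraTneq jk => ->; rewrite befxx.
- by rewrite orient_hull (orient_sum (P j)).
Qed.

End Convex.
End Ranked.
End Plane.

Section Parabola.
Local Open Scope ring_scope.
Variables (R : realType) (I : finType) (X : I -> nat).
Hypothesis injX : injective X.

Lemma ranked_parabola : ranked (fun i => parabola (X i)%:R : 'rV[R]_2) X.
Proof.
split=> // i j k; rewrite -!(ltr_nat R) => ij jk.
(* The Vandermonde determinant of the three abscissae. *)
rewrite [orient _ _ _](_ : _ = ((X j)%:R - (X i)%:R) * ((X k)%:R - (X i)%:R) *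
  ((X k)%:R - (X j)%:R)); last by rewrite /orient !mxE /=; ring.
by rewrite !mulr_gt0 // subr_gt0 // (lt_trans ij).
Qed.

(** The two coordinates give the mean and the second moment of the weights, so their variance about
    [X i] is zero and all mass would sit at [i], where the weight is zero. *)
Lemma convex_parabola : convex_position (fun i => parabola (X i)%:R : 'rV[R]_2).
Proof.
move=> i w w0 wi w1 E.
have Ex : \sum_j w j * (X j)%:R = (X i)%:R.
  move: (congr1 (fun z : 'rV[R]_2 => z 0 0) E); rewrite mxE /= => <-.
  by rewrite summxE; apply: eq_bigr => j _; rewrite !mxE.
have Ey : \sum_j w j * (X j)%:R ^+ 2 = (X i)%:R ^+ 2.
  move: (congr1 (fun z : 'rV[R]_2 => z 0 1) E); rewrite mxE /= => <-.
  by rewrite summxE; apply: eq_bigr => j _; rewrite !mxE.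
have E0 : \sum_j w j * ((X j)%:R - (X i)%:R) ^+ 2 = 0.
  transitivity (\sum_j (w j * (X j)%:R ^+ 2 -
      ((X i)%:R *+ 2) * (w j * (X j)%:R) + (X i)%:R ^+ 2 * w j)).
    by apply: eq_bigr => j _; ring.
  by rewrite big_split sumrB -!mulr_sumr Ex Ey w1 /=; ring.
have wz j : w j = 0.
  have [->//|ne] := eqVneq j i.
  have /psumr_eq0P : forall j, true -> 0 <= w j * ((X j)%:R - (X i)%:R) ^+ 2.
    by move=> ? _; rewrite mulr_ge0 ?sqr_ge0.
  move=> /(_ E0 j isT) /eqP; rewrite mulf_eq0 sqrf_eq0 => /orP[/eqP //|].
  by rewrite subr_eq0 eqr_nat (inj_eq injX) (negbTE ne).
by move: w1; rewrite big1 // => /eqP; rewrite eq_sym oner_eq0.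
Qed.

End Parabola.

(** * Chains among segments in convex position *)

Section Chords.
Variables (R : realType) (n : nat) (S : seg_family R n).
Variable rk : 'I_n * bool -> nat.
Hypothesis rkS : ranked (endpoint S) rk.

Definition lo (i : 'I_n) := minn (rk (i, false)) (rk (i, true)).
Definition hi (i : 'I_n) := maxn (rk (i, false)) (rk (i, true)).

Lemma rk_eq w w' : (rk w == rk w') = (w == w').
Proof. exact: inj_eq rkS.1 _ _. Qed.

Lemma lo_or_hi i b : (rk (i, b) == lo i) || (rk (i, b) == hi i).
Proof. by rewrite /lo /hi; case: b; lia. Qed.

Lemma lo_lt_hi i : lo i < hi i.
Proof.
have := rk_eq (i, false) (i, true); rewrite xpair_eqE eqxx /= /lo /hi; lia.
Qed.

Lemma betweenE i w : between rk (i, false) (i, true) w = (lo i < rk w < hi i).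
Proof. by []. Qed.

Lemma disjoint_laminar : disjoint_family S -> laminar lo hi [set: 'I_n]%SET.
Proof.
move=> dS; split=> [i _|i j _ _ ij]; first exact: lo_lt_hi.
have e : between rk (j, false) (j, true) (i, false) =
         between rk (j, false) (j, true) (i, true).
  apply/eqP/negPn/negP => h.
  have [] := ranked_crosses rkS _ _ _ _ _ _ h; rewrite ?xpair_eqE ?(negbTE ij) ?eqxx //.
  move=> z [/open_segment_sub z1 /open_segment_sub z2].
  have := dS i j ij; rewrite -subset0 => /(_ z); apply; split.
    exact: z1.
  exact: z2.
have neq b c : rk (i, b) != rk (j, c).
  by rewrite rk_eq xpair_eqE (negbTE ij).
move: e; rewrite !betweenE /inside.
have := neq false false; have := neq false true; have := neq true false.
have := neq true true; rewrite /lo /hi; move: (rk (i, false)) (rk (i, true)).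
by move: (rk (j, false)) (rk (j, true)) => a b c d; lia.
Qed.

Lemma inside_between i j b : disjoint_family S -> i != j ->
  inside lo hi i j = between rk (j, false) (j, true) (i, b).
Proof.
move=> /disjoint_laminar [_ /(_ i j)]; rewrite !inE => /(_ isT isT) h ij.
have := h ij; have := lo_or_hi i b; have := lo_lt_hi i; have := lo_lt_hi j.
rewrite betweenE /inside; move: (lo i) (lo j) (hi i) (hi j) (rk (i, b)).
by move=> a a' c c' e; lia.
Qed.

Lemma side_between i j b : disjoint_family S -> i != j ->
  side lo hi j i = between rk (j, false) (j, true) (i, b).
Proof. by move=> dS ij; rewrite /side (negbTE ij) (inside_between b). Qed.

End Chords.

(** Every clause of [terminal] only compares two sides of one chord, and such comparisons do not
    depend on the ranking. *)
Lemma terminal_ranked (R : realType) n (S : seg_family R n) rk rk'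
  (A : {set 'I_n}) c :
  disjoint_family S -> ranked (endpoint S) rk -> ranked (endpoint S) rk' ->
  c \in A -> terminal (lo rk) (hi rk) A c -> terminal (lo rk') (hi rk') A c.
Proof.
move=> dS hr hr' cA.
have same y z z' : z != y -> z' != y ->
    (side (lo rk') (hi rk') y z == side (lo rk') (hi rk') y z') =
    (side (lo rk) (hi rk) y z == side (lo rk) (hi rk) y z').
  move=> zy z'y; rewrite !(side_between _ false dS) //.
  by rewrite !(between_orient (P := endpoint S)) // xpair_eqE ?(negbTE zy) ?(negbTE z'y) ?andbF.
case=> t1 t2; split.
  move=> z z' zA z'A zc z'c; apply/eqP; rewrite same //; exact/eqP/t1.
move=> y1 y2 z1 z2 y1A y2A z1A z2A y1c y2c zy1 zy2.
have [->|y12] := eqVneq y1 y2; first by constructor 1.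
have y21 : y2 != y1 by rewrite eq_sym.
have cy1 : c != y1 by rewrite eq_sym.
have cy2 : c != y2 by rewrite eq_sym.
rewrite !same // => h1 h2.
by case: (t2 y1 y2 z1 z2) => // h; [constructor 1|constructor 2|constructor 3].
Qed.

(** * From an alternating path to a walk of chords *)

Section Walk.
Variables (R : realType) (n : nat) (S : seg_family R n).
Variable rk : 'I_n * bool -> nat.
Hypotheses (rkS : ranked (endpoint S) rk) (cS : convex_family S).
Variable v : seq 'rV[R]_2.
Hypothesis altv : alternating_path S v.

Let dS := cS.1.
Local Notation "v `_ i" := (nth (GRing.zero : 'rV[R]_2) v i).

Lemma member_segment i j : is_member S v i j ->
  segment (S j).1 (S j).2 = chain_segment v i.
Proof. by case=> ->; rewrite /chain_segment //= segmentC. Qed.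

Lemma member_inj i j j' : is_member S v i j -> is_member S v i j' -> j = j'.
Proof.
move=> /member_segment e /member_segment e'; apply/eqP/negPn/negP => /dS.
by rewrite e e' -subset0 => /(_ v`_i); apply; split; apply: segment_left.
Qed.

Lemma member_endpoints i j : is_member S v i j ->
  exists b, v`_i = endpoint S (j, b) /\ v`_i.+1 = endpoint S (j, ~~ b).
Proof. by rewrite /endpoint; case=> e; [exists false|exists true]; rewrite /= e. Qed.

Lemma chain_walk : 0 < num_visited S v -> exists s : seq 'I_n,
  [/\ uniq s, size s = num_visited S v,
      sorted (unsep (lo rk) (hi rk) [set j in s]%SET) s
    & compatible S v -> sorted (unsep (lo rk) (hi rk) [set: 'I_n]%SET) s].
Proof.
case: altv => -[_ _ _ disj] [b alt] /card_gt0P[j0 _].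
pose J i := xget j0 [set j | is_member S v i j]%classic.
have JP i : i.+1 < size v -> odd i = b -> is_member S v i (J i).
  by move=> iv ib; apply: xgetPex; apply/alt.
(* The chain has [(size v).-1] segments, and those in [S] are at the positions of parity [b],
   counted as 0 or 1; [M] is their number. *)
pose M := uphalf ((size v).-1 - b).
have tM t : (t < M) = ((b + t.*2).+1 < size v) by rewrite /M; lia.
have oddt t : odd (b + t.*2) = b by rewrite oddD odd_double addbF; case: (b).
pose s := [seq J (b + t.*2) | t <- iota 0 M].
have sP t : t < M -> nth j0 s t = J (b + t.*2).
  by move=> h; rewrite (nth_map 0) ?size_iota // nth_iota.
have szs : size s = M by rewrite size_map size_iota.
have sc j : reflect (in_chain S v j) (j \in s).
  apply: (iffP mapP) => [[t]|[i iv ij]].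
    rewrite mem_iota add0n tM /= => tv ->; exists (b + t.*2) => //.
    exact: JP.
  have ib : odd i = b by apply/alt => //; exists j.
  have ei : i = b + i./2.*2 by rewrite -ib odd_double_half.
  exists i./2; first by rewrite mem_iota add0n tM /= -ei.
  by rewrite -ei; apply: (member_inj ij); apply: JP.
have us : uniq s.
  rewrite map_inj_in_uniq ?iota_uniq // => t t'; rewrite !mem_iota !add0n /=.
  wlog tt : t t' / t < t' => [H tm t'm e|].
    have [h|h|//] := ltngtP t t'; first exact: H.
    by apply/esym/H.
  rewrite !tM => tv t'v e.
  have m := JP _ tv (oddt t); have m' := JP _ t'v (oddt t').
  have := disj (b + t.*2) (b + t'.*2); rewrite t'v -(member_segment m).
  rewrite e (member_segment m') setIid => /(_ _ isT) h; exfalso.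
  have : set0 v`_(b + t'.*2) by rewrite -h; [apply: segment_left|lia].
  by [].
have sz : size s = num_visited S v.
  rewrite /num_visited -(card_uniqP us); apply: eq_card => j.
  by rewrite inE; apply/sc/asboolP.
(* The segment joining two successive visited chords has one end on each, so it crosses any chord
   separating them. *)
have conn t d : t.+1 < M -> d != J (b + t.*2) -> d != J (b + t.+1.*2) ->
    inside (lo rk) (hi rk) (J (b + t.*2)) d !=
    inside (lo rk) (hi rk) (J (b + t.+1.*2)) d ->
    crosses v`_(b + t.*2).+1 v`_(b + t.*2).+2 (S d).1 (S d).2.
  move=> tm dt dt'; have tv : (b + t.*2).+1 < size v by rewrite -tM ltnW.
  have tv' : (b + t.+1.*2).+1 < size v by rewrite -tM.
  have [c [_ ->]] := member_endpoints (JP _ tv (oddt t)).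
  have -> : (b + t.*2).+2 = b + t.+1.*2 by rewrite doubleS !addnS.
  have [c' [-> _]] := member_endpoints (JP _ tv' (oddt t.+1)).
  rewrite eq_sym in dt; rewrite eq_sym in dt'.
  rewrite (inside_between rkS (~~ c) dS dt) (inside_between rkS c' dS dt') => h.
  apply: (ranked_crosses rkS _ _ _ _ _ _ h);
    rewrite ?xpair_eqE ?(negbTE dt) ?(negbTE dt') ?andbF //.
  have tM' : t < M by apply: ltnW.
  by rewrite negb_and -!sP // nth_uniq ?szs // ltn_eqF.
have nocr t d : t.+1 < M -> d != J (b + t.*2) -> d != J (b + t.+1.*2) ->
    d \in s -> crosses v`_(b + t.*2).+1 v`_(b + t.*2).+2 (S d).1 (S d).2 -> False.
  move=> tm dt dt' /sc[i iv im].
  move=> [z [/open_segment_sub z1 /open_segment_sub]].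
  rewrite (member_segment im) => z2.
  have ib : odd i = b by apply/alt => //; exists d.
  have ei : i = b + i./2.*2 by rewrite -ib odd_double_half.
  have tv : (b + t.+1.*2).+1 < size v by rewrite -tM.
  have ed : d = J i by apply: (member_inj im); apply: JP.
  have nt : i./2 != t by apply: contraNneq dt => <-; rewrite -ei ed.
  have nt' : i./2 != t.+1 by apply: contraNneq dt' => <-; rewrite -ei ed.
  (* A visited chord other than the two joined ones is not adjacent in the chain to the connecting
     segment, hence disjoint from it. *)
  have [lt|gt] : i.+1 < (b + t.*2).+1 \/ (b + t.*2).+2 < i.
    by rewrite ei; clear -nt nt'; lia.
    have := disj _ _ lt; rewrite -subset0 => h; apply: (h _ z).
      by clear -tv; lia.
    by split.
  have := disj _ _ gt iv; rewrite -subset0 => h; apply: (h z).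
  by split.
exists s; split=> //.
  apply/(sortedP j0) => t; rewrite szs => tm; rewrite !sP //; last by apply: ltnW.
  apply/unsepP => d; rewrite inE => /sc[i iv im] dt dt'.
  apply/eqP/negPn/negP => /(conn t d tm dt dt'); apply: nocr => //.
  by apply/sc; exists i.
move=> cv; apply/(sortedP j0) => t; rewrite szs => tm; rewrite !sP //; last by apply: ltnW.
apply/unsepP => d _ dt dt'; apply/eqP/negPn/negP => h.
have cr := conn t d tm dt dt' h.
have [ds|ds] := boolP (d \in s); first exact: (nocr t d).
apply: (cv d _ _ _ cr); first by move/sc; apply/negP.
by have := tm; rewrite tM; clear; lia.
Qed.

End Walk.

(** * From a terminal chord to an alternating path *)

Section Doubling.
Variables (T : Type) (f : T -> T).

Fixpoint with_images (s : seq T) :=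
  if s is x :: s' then [:: x, f x & with_images s'] else [::].

Lemma size_with_images s : size (with_images s) = (size s).*2.
Proof. by elim: s => //= x s ->. Qed.

Lemma nth_with_images x0 s i : i < (size s).*2 ->
  nth x0 (with_images s) i =
  if odd i then f (nth x0 s i./2) else nth x0 s i./2.
Proof.
elim: s i => // x s IH [|[|i]] //= h; rewrite negbK.
exact: IH.
Qed.

End Doubling.

Section Zigzag.
Variables (T : Type) (rk : T -> nat).

Fixpoint zigzag (s : seq T) : bool :=
  if s is x :: s' then
    (all (fun y => rk x < rk y) s' || all (fun y => rk y < rk x) s') && zigzag s'
  else true.

Lemma zigzag_nth x0 s i : zigzag s ->
  (forall j, i < j < size s -> rk (nth x0 s i) < rk (nth x0 s j)) \/
  (forall j, i < j < size s -> rk (nth x0 s j) < rk (nth x0 s i)).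
Proof.
elim: s i => [|x s IH] i /=; first by left=> j; rewrite ltn0 andbF.
case: i => [|i] /andP[h zs] /=; last first.
  by have [k|k] := IH i zs; [left|right] => -[|j] //=; rewrite !ltnS; apply: k.
case/orP: h => /all_nthP k; [left|right] => -[|j] //=; rewrite ltnS; exact: k.
Qed.

End Zigzag.

Section ZigzagOrder.
Variables (n : nat) (rk : 'I_n * bool -> nat).
Local Notation lo := (lo rk).
Local Notation hi := (hi rk).

Definition other_end (w : 'I_n * bool) := (w.1, ~~ w.2).

Lemma with_other_end_mem (s : seq ('I_n * bool)) w :
  w \in with_images other_end s -> w.1 \in map fst s.
Proof.
elim: s => //= x s IH; rewrite !inE => /or3P[/eqP->|/eqP->|/IH ->];
  by rewrite ?eqxx ?orbT.
Qed.

(* Either the leftmost chord or the rightmost chord is empty, or the outermost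
   chord encloses all the others: it can be removed first. *)
Lemma zigzag_ex (A : {set 'I_n}) : laminar lo hi A ->
  (forall y1 y2 z1 z2, y1 \in A -> y2 \in A -> z1 \in A -> z2 \in A ->
     inside lo hi z1 y1 -> inside lo hi z2 y2 ->
     [\/ y1 = y2, inside lo hi y1 y2 | inside lo hi y2 y1]) ->
  exists s : seq ('I_n * bool), [/\ uniq (map fst s), map fst s =i A &
    zigzag rk (with_images other_end s)].
Proof.
move: {2}#|A| (leqnn #|A|) => m; elim: m A => [|m IH] A hm lA chain.
  move: hm; rewrite leqn0 cards_eq0 => /eqP->; exists [::]; split=> // x.
  by rewrite !inE.
have [->|[a0 a0A]] := set_0Vmem A.
  by exists [::]; split=> // x; rewrite !inE.
have lohi w : (rk w == lo w.1) || (rk w == hi w.1).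
  by case: w => i b; apply: lo_or_hi.
(* [P] and [Q] record whether the first and the second end of the removed chord are smallest ([ltn])
   or largest ([gtn]). *)
have step a b (P Q : nat -> nat -> bool) : a \in A ->
    (P = ltn \/ P = gtn) -> (Q = ltn \/ Q = gtn) ->
    P (rk (a, b)) (rk (a, ~~ b)) ->
    (forall w, w.1 \in A -> w.1 != a ->
       P (rk (a, b)) (rk w) && Q (rk (a, ~~ b)) (rk w)) ->
    exists s : seq ('I_n * bool), [/\ uniq (map fst s), map fst s =i A &
      zigzag rk (with_images other_end s)].
  move=> aA hP hQ Pab hw.
  have sub : A :\ a \subset A by apply: subD1set.
  have /fintype.subsetP sub' := sub.
  have [||y1 y2 z1 z2 /sub' ? /sub' ? /sub' ? /sub' ? ? ?|s [us sA zs]] := IH (A :\ a).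
  - by rewrite -ltnS (leq_trans _ hm) // [X in _ < X](cardsD1 a) aA.
  - exact: laminarS lA.
  - exact: (chain y1 y2 z1 z2).
  have hs w : w \in with_images other_end s ->
      P (rk (a, b)) (rk w) && Q (rk (a, ~~ b)) (rk w).
    by move=> /with_other_end_mem; rewrite sA !inE => /andP[wa wA]; apply: hw.
  exists ((a, b) :: s); split.
  - by rewrite /= us sA !inE eqxx.
  - by move=> x; rewrite /= inE sA !inE; case: eqVneq => // ->.
  rewrite /= zs andbT; apply/andP; split.
    case: hP Pab hs => -> /= Pab hs; apply/orP; [left|right];
      by rewrite /= Pab /=; apply/allP => w /hs /andP[].
  case: hQ hs => -> /= hs; apply/orP; [left|right];
    by apply/allP => w /hs /andP[].
have lohi' i : exists b, rk (i, b) = lo i /\ rk (i, ~~ b) = hi i.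
  by rewrite /lo /hi; case: (leqP (rk (i, false)) (rk (i, true))) => h;
    [exists false|exists true]; rewrite /=; lia.
case: (@arg_minnP _ a0 [in A] lo a0A) => a aA amin.
case: (@arg_maxnP _ a0 [in A] hi a0A) => c cA cmax.
have ltlh i : i \in A -> lo i < hi i by apply: lA.1.
have [[z1 z1A z1a]|na] : (exists2 z, z \in A & inside lo hi z a) \/
    forall z, z \in A -> ~~ inside lo hi z a.
  have [/exists_inP h|/exists_inPn h] := boolP [exists z in A, inside lo hi z a].
    by left.
  by right.
  have [[z2 z2A z2c]|nc] : (exists2 z, z \in A & inside lo hi z c) \/
      forall z, z \in A -> ~~ inside lo hi z c.
    have [/exists_inP h|/exists_inPn h] := boolP [exists z in A, inside lo hi z c].
      by left.
    by right.
  - have ca : a = c.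
      have := amin c cA; have := cmax a aA; rewrite /inside.
      case: (chain a c z1 z2) => // [|]; rewrite /inside; lia.
    subst c; have [b [b1 b2]] := lohi' a.
    apply: (step a b ltn gtn) => //; [by left|by right|by rewrite b1 b2 /= ltlh|].
    move=> w wA wa; have := lA.2 _ _ wA aA wa; have := amin _ wA; have := cmax _ wA.
    have := ltlh _ wA; have := ltlh _ aA; rewrite b1 b2 /=; have := lohi w.
    rewrite /inside; move: (rk w) (lo w.1) (hi w.1) (lo a) (hi a).
    by clear; lia.
  have [b [b1 b2]] := lohi' c.
  apply: (step c (~~ b) gtn gtn) => //; [by right|by right|by rewrite negbK b1 b2 /= ltlh|].
  move=> w wA wa; have := lA.2 _ _ wA cA wa; have := cmax _ wA.
  have := nc _ wA; have := ltlh _ wA; have := ltlh _ cA; rewrite negbK b1 b2 /=; have := lohi w.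
  rewrite /inside; move: (rk w) (lo w.1) (hi w.1) (lo c) (hi c).
  by clear; lia.
have [b [b1 b2]] := lohi' a.
apply: (step a b ltn ltn) => //; [by left|by left|by rewrite b1 b2 /= ltlh|].
move=> w wA wa; have := lA.2 _ _ wA aA wa; have := amin _ wA.
have := na _ wA; have := ltlh _ wA; have := ltlh _ aA; rewrite b1 b2 /=; have := lohi w.
rewrite /inside; move: (rk w) (lo w.1) (hi w.1) (lo a) (hi a).
by clear; lia.
Qed.

End ZigzagOrder.

Section ZigzagPath.
Variables (R : realType) (n : nat) (S : seg_family R n).
Hypothesis cS : convex_family S.
Let dS := cS.1.
Local Notation "v `_ i" := (nth (GRing.zero : 'rV[R]_2) v i).

Lemma zigzag_path rk (s : seq ('I_n * bool)) : ranked (endpoint S) rk ->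
  0 < size s -> uniq (map fst s) -> zigzag rk (with_images (@other_end n) s) ->
  let v := map (endpoint S) (with_images (@other_end n) s) in
  alternating_path S v /\ (forall j, in_chain S v j <-> j \in map fst s).
Proof.
move=> rkS s0 us zs; set ws := with_images _ s => v.
have [w0 _] : exists w0 : 'I_n * bool, w0 \in s.
  by case: (s) s0 => // w0 s' _; exists w0; rewrite mem_head.
have zn := zigzag_nth w0 _ zs; rewrite -/ws in zn.
have szv : size v = (size s).*2 by rewrite size_map size_with_images.
have szws : size ws = (size s).*2 by rewrite size_with_images.
have vE i : i < size v -> v`_i = endpoint S (nth w0 ws i).
  by move=> h; rewrite (nth_map w0) // szws -szv.
have wsE i : i < size v -> nth w0 ws i =
    if odd i then other_end (nth w0 s i./2) else nth w0 s i./2.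
  by move=> h; rewrite nth_with_images // -szv.
have lt i j : i < j -> j < size v -> nth w0 ws i != nth w0 ws j.
  move=> ij jv; apply/eqP => e.
  by case: (zn i) => /(_ j); rewrite ij szws -szv e jv ltnn => /(_ isT).
have inj i j : i < size v -> j < size v -> i != j -> nth w0 ws i != nth w0 ws j.
  move=> iv jv; rewrite neq_ltn => /orP[h|h]; first exact: lt.
  by rewrite eq_sym; apply: lt.
have Pinj : injective (endpoint S).
  by move=> x y e; apply/eqP/negPn/negP => /(convex_inj cS.2); rewrite e eqxx.
have fsteq i j : i < size v -> j < size v ->
    (nth w0 ws i).1 = (nth w0 ws j).1 -> i./2 = j./2.
  move=> iv jv; rewrite !wsE // => e.
  have [i2 j2] : i./2 < size s /\ j./2 < size s by split; lia.
  have e' : nth w0.1 (map fst s) i./2 = nth w0.1 (map fst s) j./2.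
    by rewrite !(nth_map w0) //; move: e; case: odd; case: odd.
  by apply/eqP; rewrite -(nth_uniq w0.1 _ _ us) ?size_map // e'.
have mem i : i.+1 < size v -> ~~ odd i -> is_member S v i (nth w0 ws i).1.
  move=> iv io; rewrite /is_member !vE //; last exact: ltnW.
  have -> : nth w0 ws i.+1 = other_end (nth w0 ws i).
    rewrite !wsE //=; last exact: ltnW.
    by rewrite (negbTE io) /= uphalf_half (negbTE io).
  by case: (nth w0 ws i) => j [] /=; [right|left]; rewrite /endpoint /=; case: (S j).
have memI i j : i.+1 < size v -> is_member S v i j ->
    ~~ odd i /\ j = (nth w0 ws i).1.
  move=> iv; have iv' := ltnW iv; rewrite /is_member !vE // => h.
  have [b [e1 e2]] : exists b, (j, b) = nth w0 ws i /\ (j, ~~ b) = nth w0 ws i.+1.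
    by case: h => h; [exists false|exists true]; split; apply: Pinj;
      rewrite {1}/endpoint /= h.
  have := fsteq i i.+1 iv' iv; rewrite -e1 -e2 /= uphalf_half => /(_ erefl).
  by case: odd => //= h'; clear -h'; lia.
have alt : alternating_path S v.
  split; last first.
    exists false => i iv; split=> [[j /(memI _ _ iv)[/negbTE]]//|/negbT io].
    by exists (nth w0 ws i).1; apply: mem.
  split.
  - by rewrite szv; lia.
  - move=> i iv; have iv' := ltnW iv; rewrite !vE // => /Pinj /eqP; apply/negP.
    by apply: lt.
  - move=> i iv; have iv' := ltnW iv; have iv'' := ltnW iv'.
    rewrite /chain_segment !vE //; apply: (ranked_consecutive rkS); apply: inj => //;
      by clear; lia.
  - move=> i j ij jv; have jv' := ltnW jv.
    have iv : i.+1 < size v by apply: ltn_trans ij jv'.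
    have iv' := ltnW iv.
    rewrite /chain_segment !vE //; apply: (ranked_disjoint rkS);
      try (apply: inj => //; clear -ij; lia).
    (* An earlier vertex is extreme with respect to both ends of segment [j], so it is not between
       them: both ends of segment [i] are on one side of segment [j]. *)
    have aux k : k < j -> between rk (nth w0 ws j) (nth w0 ws j.+1) (nth w0 ws k) = false.
      move=> kj; rewrite /between; case: (zn k) => h;
        have := h j; have := h j.+1; rewrite szws -szv jv jv' kj (ltn_trans kj) //;
        move=> /(_ isT) + /(_ isT); clear; lia.
    by rewrite !aux // ltnW.
split=> // j; split=> [[i iv /(memI _ _ iv)[io ->]]|/mapP[w ws' ->]].
  have i2 : i./2 < size s by clear -iv szv; lia.
  by rewrite wsE ?(ltnW iv) // (negbTE io) map_f // mem_nth.
pose t := index w s; have ts : t < size s by rewrite index_mem.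
have tv : t.*2.+1 < size v by rewrite szv; clear -ts; lia.
exists t.*2 => //; have := mem _ tv; rewrite odd_double wsE ?(ltnW tv) //.
by rewrite odd_double doubleK nth_index // => /(_ isT).
Qed.

Lemma terminal_path rk (A : {set 'I_n}) c : ranked (endpoint S) rk -> c \in A ->
  terminal (lo rk) (hi rk) A c -> exists v,
  [/\ alternating_path S v, num_visited S v = #|A| &
    (forall d, d \notin A -> forall x y, x \in A -> y \in A ->
      side (lo rk) (hi rk) d x = side (lo rk) (hi rk) d y) -> compatible S v].
Proof.
move=> rkS cA tc.
(* After this cut no chord encloses [c], so being across [y] from [c] means being inside [y]. *)
have [rk' rkS' rk0] := convex_ranked cS.2 (c, false).
have [t1 t2] := terminal_ranked dS rkS rkS' cA tc.
have lam := disjoint_laminar rkS' dS.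
have lamA := laminarS (finset.subsetT A) lam.
have lo0 : lo rk' c = 0 by rewrite /lo rk0 min0n.
have cin y : inside (lo rk') (hi rk') c y = false by rewrite /inside lo0.
have [|s [us sA zs]] := zigzag_ex lamA.
  move=> y1 y2 z1 z2 y1A y2A z1A z2A h1 h2.
  have [->|y12] := eqVneq y1 y2; first by constructor 1.
  have ins z y : inside (lo rk') (hi rk') z y -> z != c.
    by apply: contraTneq => ->; rewrite cin.
  have sd z y : z != y -> side (lo rk') (hi rk') y z = inside (lo rk') (hi rk') z y.
    by rewrite /side => /negbTE ->.
  (* If [c] itself encloses a chord of [A], it encloses all the others, as they are on one side of
     it. *)
  have [e|y1c] := eqVneq y1 c.
    rewrite e in h1 y12 *; constructor 3; rewrite eq_sym in y12.
    by rewrite -sd // (t1 y2 z1) // ?(ins _ _ h1) // sd // (ins _ _ h1).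
  have [e|y2c] := eqVneq y2 c.
    rewrite e in h2 y12 *; constructor 2.
    by rewrite -sd // (t1 y1 z2) // ?(ins _ _ h2) // sd // (ins _ _ h2).
  have cy1 : c != y1 by rewrite eq_sym.
  have cy2 : c != y2 by rewrite eq_sym.
  have y21 : y2 != y1 by rewrite eq_sym.
  have := t2 y1 y2 z1 z2 y1A y2A z1A z2A y1c y2c (inside_neq h1) (inside_neq h2).
  rewrite !sd ?(inside_neq h1) ?(inside_neq h2) // h1 h2 !cin.
  move=> /(_ isT isT) [|h|h]; first by constructor 1.
    by constructor 3; move: h; case: inside.
  by constructor 2; move: h; case: inside.
have s0 : 0 < size s.
  by have : c \in map fst s; [rewrite sA|case: (s)].
have [alt inc] := zigzag_path rkS' s0 us zs.
set v := map _ _ in alt inc.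
exists v; split=> //.
  apply: eq_card => j; rewrite inE -sA; apply/asboolP/idP; first by move/inc.
  by move=> h; apply/inc.
move=> comp d dv i iv [z [/open_segment_sub z1 /open_segment_sub z2]].
(* All vertices of the chain are ends of chords of [A], and these lie on one side of [d]. *)
have dA : d \notin A by apply/negP => dA; apply: dv; apply/inc; rewrite sA.
have vin k : k < size v -> exists2 w, w.1 \in A & v`_k = endpoint S w.
  move=> kv; have : v`_k \in v by apply: mem_nth.
  by move=> /mapP[w /with_other_end_mem]; rewrite sA; exists w.
have [[w1 c1] /= w1A e1] := vin i (ltnW iv); have [[w2 c2] /= w2A e2] := vin i.+1 iv.
have w1d : w1 != d by apply: contraNneq dA => <-.
have w2d : w2 != d by apply: contraNneq dA => <-.
have := @ranked_disjoint _ _ _ _ (d, false) (d, true) (w1, c1) (w2, c2) rkS.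
rewrite !xpair_eqE (negbTE w1d) (negbTE w2d) eqxx -e1 -e2 -subset0.
move=> /(_ isT isT isT isT isT); rewrite -(side_between rkS c1 dS w1d).
rewrite -(side_between rkS c2 dS w2d) => /(_ (comp d dA _ _ w1A w2A)).
by move=> /(_ z); apply; split.
Qed.

End ZigzagPath.

(** * The two translations between trees and families of segments *)

Section FamilyOfTree.
Variables (R : realType) (T : graph) (l r : T -> nat) (t : T).
Hypothesis mT : models l r (@id T) [set: T]%SET t.
Let lT := mod_lam mT.
Variables (m : nat) (f : 'I_m -> T).
Hypothesis injf : injective f.

Definition bracket_rank (w : 'I_m * bool) := if w.2 then r (f w.1) else l (f w.1).

(** In its uses [f] enumerates the brackets other than [t], giving one chord for each edge. *)
Definition bracket_family : seg_family R m :=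
  fun i => (parabola (l (f i))%:R, parabola (r (f i))%:R)%R.

Let lr x : l x < r x. Proof. exact: lT.1 (finset.in_setT x). Qed.

Let bracket_rank_inj : injective bracket_rank.
Proof.
move=> [i b] [j c] /eqP; have [->|ij] := eqVneq i j.
  by have := lr (f j); case: b; case: c; rewrite /bracket_rank //=; lia.
have := lT.2 (f i) (f j); rewrite (inj_eq injf) ij.
move=> /(_ (finset.in_setT _) (finset.in_setT _) isT).
have := lr (f i); have := lr (f j); case: b; case: c;
  by rewrite /bracket_rank /inside /=; clear; lia.
Qed.

Let endpointE : endpoint bracket_family = fun w => parabola (bracket_rank w)%:R%R.
Proof. by apply/funext => -[i []]. Qed.

Lemma ranked_bracket_family : ranked (endpoint bracket_family) bracket_rank.
Proof. by rewrite endpointE; apply: ranked_parabola. Qed.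

Lemma lo_bracket i : lo bracket_rank i = l (f i).
Proof. by rewrite /lo /bracket_rank /=; have := lr (f i); lia. Qed.

Lemma hi_bracket i : hi bracket_rank i = r (f i).
Proof. by rewrite /hi /bracket_rank /=; have := lr (f i); lia. Qed.

Lemma convex_bracket_family : convex_family bracket_family.
Proof.
split; last by rewrite endpointE; apply: convex_parabola.
move=> i j ij.
have h := ranked_disjoint ranked_bracket_family (i := (j, false)) (j := (j, true))
  (k := (i, false)) (l := (i, true)).
rewrite !xpair_eqE (negbTE ij) eqxx in h; apply: h => //.
rewrite !betweenE lo_bracket hi_bracket /bracket_rank /=.
have := lT.2 (f i) (f j); rewrite (inj_eq injf) ij.
move=> /(_ (finset.in_setT _) (finset.in_setT _) isT).
have := lr (f i); have := lr (f j).
by rewrite /inside; clear; lia.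
Qed.

Lemma unsep_bracket (A : {set 'I_m}) i j : unsep (lo bracket_rank) (hi bracket_rank) A i j ->
  forall d, d \in A -> f d != f i -> f d != f j -> inside l r (f i) (f d) = inside l r (f j) (f d).
Proof.
move=> /unsepP h d dA; rewrite !(inj_eq injf) => di dj.
by have := h d dA di dj; rewrite /inside !lo_bracket !hi_bracket.
Qed.

End FamilyOfTree.

Section TreeOfFamily.
Variables (R : realType) (m : nat) (S : seg_family R m) (rk : 'I_m * bool -> nat).
Hypotheses (dS : disjoint_family S) (rkS : ranked (endpoint S) rk).

Definition max_rank := \max_w rk w.

(** [None] is the added root, the region outside all brackets; the shift by one makes room for it to
    enclose them strictly. *)
Definition opt_lo (x : option 'I_m) := if x is Some i then (lo rk i).+1 else 0.
Definition opt_hi (x : option 'I_m) :=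
  if x is Some i then (hi rk i).+1 else max_rank.+2.

Definition dual_tree := bracket_graph opt_lo opt_hi.

Lemma hi_max i : hi rk i <= max_rank.
Proof. by rewrite /hi geq_max !leq_bigmax. Qed.

Lemma dual_models :
  models opt_lo opt_hi (id : dual_tree -> option 'I_m) [set: option 'I_m]%SET None.
Proof.
have lam := disjoint_laminar rkS dS.
apply: bracket_models.
  split=> [[i|] _ //=|[i|] [j|] _ _ //= ij].
  - by have := lam.1 i (finset.in_setT i); clear; lia.
  - have ne : i != j by apply: contra ij => /eqP->.
    have := lam.2 i j (finset.in_setT i) (finset.in_setT j) ne.
    by rewrite /inside /=; clear; lia.
  - by rewrite /inside /=; have := hi_max i; clear; lia.
  - by rewrite /inside /=; have := hi_max j; clear; lia.
by case=> // i _; rewrite /inside /=; have := hi_max i; clear; lia.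
Qed.

Lemma dual_is_tree : is_tree dual_tree.
Proof. exact: models_tree dual_models. Qed.

Lemma dual_num_edges : num_edges dual_tree = m.
Proof. by rewrite (models_num_edges dual_models) cardsT card_option card_ord. Qed.

Lemma side_Some i j : side opt_lo opt_hi (Some i) (Some j) = side (lo rk) (hi rk) i j.
Proof. by rewrite /side /inside /= !ltnS. Qed.

Lemma caterpillar_path (H : graph) (phi : H -> option 'I_m) B t : convex_family S ->
  models opt_lo opt_hi phi B t -> is_caterpillar H -> 0 < num_edges H ->
  exists2 v, alternating_path S v /\ num_visited S v = num_edges H &
    ((forall d, Some d \notin B -> forall x y, x \in B -> y \in B ->
      side opt_lo opt_hi (Some d) x = side opt_lo opt_hi (Some d) y) ->
    compatible S v).
Proof.
move=> cS mH cH; rewrite (models_num_edges mH) => k0.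
have cardB : #|B :\ t| = #|B|.-1 by rewrite (cardsD1 t B) (mod_topA mH).
have [|c cB [t1 t2]] := caterpillar_terminal mH cH; first by rewrite cardB.
(* Nothing encloses [None], so it can only be the root: all edges of [H] are chords. *)
have noN : None \notin B :\ t.
  rewrite !inE; apply/negP => /andP[Nt NB]; have := mod_top mH NB Nt.
  by rewrite /inside ltn0.
pose A := [set j | Some j \in B :\ t]%SET.
have AE z : (z \in A) = (Some z \in B :\ t) by rewrite inE.
have AB : B :\ t = [set Some j | j in A]%SET.
  apply/setP => -[j|]; last first.
    by rewrite (negbTE noN); apply/esym/imsetP => -[].
  apply/idP/imsetP => [h|[j' h [->]]]; last by rewrite inE in h.
  by exists j; rewrite // inE.
have [j cj] : exists j, c = Some j by case: c cB {t1 t2} (negbTE noN) => [j|->] //; exists j.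
subst c.
have [||v [alt nv comp]] := @terminal_path _ _ _ cS rk A j rkS.
- by rewrite inE.
- split=> [z z'|y1 y2 z1 z2]; rewrite !AE -!side_Some.
    by move=> zB z'B zj z'j; apply: t1.
  move=> y1B y2B z1B z2B y1j y2j z1y z2y h1 h2.
  case: (t2 (Some y1) (Some y2) (Some z1) (Some z2)) => // [[]|h|h].
  + by constructor 1.
  + by constructor 2.
  + by constructor 3.
exists v; first split=> //.
  by rewrite nv -cardB AB card_imset //; apply: Some_inj.
move=> h; apply: comp => d dA x y; rewrite !inE => /andP[xt xB] /andP[yt yB].
rewrite -!side_Some; have [dB|dB] := boolP (Some d \in B); last exact: h.
(* A chord of [B] outside [A] is the root of [H], which encloses all of [A] and separates nothing in
   it. *)
have dt : Some d = t.
  by apply/eqP; apply: contraNT dA => dt; rewrite !inE dt.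
have sd z : Some z \in B -> Some z != t -> side opt_lo opt_hi (Some d) (Some z).
  by move=> zB zt; rewrite dt /side (mod_top mH zB zt) orbT.
by rewrite !sd.
Qed.

End TreeOfFamily.

(** * Agreement of the sets of attained numbers and of their maxima *)

Lemma contraction_p_set (R : realType) m k : (0 < m)%N -> (0 < k)%N ->
  contraction_set m k -> p_set R m k.
Proof.
case: m => // m _ k0 hk S cS.
have [rk rkS _] := convex_ranked cS.2 (ord0, false).
have mD := dual_models cS.1 rkS.
have [H [DH cH nH]] := hk _ (dual_is_tree cS.1 rkS) (dual_num_edges cS.1 rkS).
have [psi [B mH]] := models_contracts_to mD DH.
have [|v [alt nv] _] := caterpillar_path rkS cS mH cH; first by rewrite nH.
by exists v => //; rewrite nv.
Qed.

Lemma removal_q_set (R : realType) m k : (0 < m)%N -> (0 < k)%N ->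
  removal_set m k -> q_set R m k.
Proof.
case: m => // m _ k0 hk S cS.
have [rk rkS _] := convex_ranked cS.2 (ord0, false).
have mD := dual_models cS.1 rkS.
have [X [cH nH]] := hk _ (dual_is_tree cS.1 rkS) (dual_num_edges cS.1 rkS).
have [[t mH] comp] := induced_models (G := dual_tree rk) mD cH.1.
have [|v [alt nv] cv] := caterpillar_path rkS cS mH cH; first by rewrite nH.
exists v; last by rewrite nv.
by split=> //; apply: cv => d; apply: comp.
Qed.

Lemma tree_enum (T : graph) (t : T) m : #|T|.-1 = m ->
  exists f : 'I_m -> T, injective f /\ forall x, x != t <-> exists i, f i = x.
Proof.
move=> Tm; have e : size (enum [set~ t]%SET) = m.
  by rewrite -cardE cardsC1.
exists (fun i => nth t (enum [set~ t]%SET) i); split=> [i j /eqP|x].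
  by rewrite nth_uniq ?enum_uniq ?e // => /eqP/val_inj.
split=> [xt|[i <-]].
  have xe : x \in enum [set~ t]%SET by rewrite mem_enum !inE.
  have h : index x (enum [set~ t]%SET) < m by rewrite -e index_mem.
  by exists (Ordinal h); rewrite /= nth_index.
have : nth t (enum [set~ t]%SET) i \in enum [set~ t]%SET by rewrite mem_nth ?e.
by rewrite mem_enum !inE.
Qed.

Lemma p_set_contraction (R : realType) m k : (0 < k)%N ->
  p_set R m k -> contraction_set m k.
Proof.
move=> k0 hk T treeT Tm; have [l [r [t mT]]] := tree_models treeT.
rewrite (models_num_edges mT) cardsT in Tm.
have [f [injf fP]] := tree_enum t Tm.
have cS := convex_bracket_family R mT injf.
have [v alt nv] := hk _ cS.
have [|s [us sz ss _]] := chain_walk (ranked_bracket_family R mT injf) cS alt.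
  by rewrite nv.
have [||||H [TH cH nH]] := contraction_of_walk (s := map f s) mT.
- by rewrite size_map sz nv.
- by rewrite map_inj_uniq.
- by move=> x /mapP[i _ ->]; rewrite !inE andbT; apply/fP; exists i.
- rewrite sorted_map; apply: sub_sorted ss => i j /= ij.
  apply/unsepP => d; rewrite inE => /mapP[d' ds ->] di dj.
  by apply: (unsep_bracket mT injf ij) => //; rewrite inE.
by exists H; split=> //; rewrite nH size_map sz.
Qed.

Lemma q_set_removal (R : realType) m k : (0 < k)%N ->
  q_set R m k -> removal_set m k.
Proof.
move=> k0 hk T treeT Tm; have [l [r [t mT]]] := tree_models treeT.
rewrite (models_num_edges mT) cardsT in Tm.
have [f [injf fP]] := tree_enum t Tm.
have cS := convex_bracket_family R mT injf.
have [v [alt comp] nv] := hk _ cS.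
have [|s [us sz _ /(_ comp) ss]] := chain_walk (ranked_bracket_family R mT injf) cS alt.
  by rewrite nv.
have ft i : f i != t by apply/fP; exists i.
have [||||X [cX nX]] := removal_of_walk (s := map f s) mT.
- by rewrite size_map sz nv.
- by rewrite map_inj_uniq.
- by apply/mapP => -[i _ e]; move: (ft i); rewrite -e eqxx.
- rewrite sorted_map; apply: sub_sorted ss => i j /= ij.
  (* The root [t] has no chord, but it encloses all brackets of the walk. *)
  apply/unsepP => d _ di dj; have [->|dt] := eqVneq d t.
    by rewrite !(mod_top mT) ?ft ?inE.
  have [d' e] := (fP d).1 dt; subst d.
  by apply: (unsep_bracket mT injf ij).
by exists X; rewrite nX size_map sz.
Qed.

(** The value 0 is left out because the constructions start from a visited chord; the maxima are at
    least 1 by [q_set1]. *)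
Lemma is_max_transfer (A B : set nat) k : (0 < k)%N -> is_max A k ->
  (forall j, (0 < j)%N -> A j <-> B j) -> is_max B k.
Proof.
move=> k0 [Ak Amax] AB; split; first exact/AB.
by case=> // j Bj; apply/Amax/AB.
Qed.

Theorem proposition1 (R : realType) (m : nat) (hm : (1 <= m)%N) :
  is_max (contraction_set m) (p R m) /\ is_max (removal_set m) (q R m).
Proof.
have q1 : q_set R m 1 by case: (m) hm => // m' _; exact: q_set1.
have pm := p_spec R hm; have qm := q_spec R hm.
split.
  apply: (is_max_transfer _ pm) => [|j j0].
    by apply: pm.2; apply: q_set_sub_p_set.
  by split; [apply: p_set_contraction|apply: contraction_p_set].
apply: (is_max_transfer _ qm) => [|j j0]; first exact: qm.2.
by split; [apply: q_set_removal|apply: removal_q_set].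
Qed.
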